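(* Let $t$ be a large positive real number and let $k$ be a positive integer. If $k = \pi t + O(1)$, then $$|\widetilde{R}_{k+1}(t)| < \tfrac12 e^{-2\pi t}\left(1+O(1/t)\right).$$ That is: for every constant $C>0$ there exist constants $C'>0$ and $t_0>0$ such that for all real $t\ge t_0$ and all positive integers $k$ with $|k-\pi t|\le C$, one has $|\widetilde{R}_{k+1}(t)| < \frac12 e^{-2\pi t}(1+C'/t)$.
   Context: $B_{2j}(u)$ is the Bernoulli polynomial. $\log$ is the principal branch of the logarithm on $\mathbb{C}\setminus(-\infty,0]$. $\ln\Gamma$ denotes the analytic function on $\mathbb{C}\setminus(-\infty,0]$ with $\exp(\ln\Gamma(z))=\Gamma(z)$ that is real and equal to $\log(\Gamma(x))$ for real $x>0$. For integers $j\ge 1$, $\widehat{T}_j(z) = \frac{B_{2j}(\frac12)}{2j(2j-1)z^{2j-1}}$, and for integers $k\ge 1$ and $z\in\mathbb{C}$ with $\Re(z)\ge0$, $z\neq0$, the remainder $\widehat{R}_k(z)$ is defined by $$\ln\Gamma(z+\tfrac12) = z\log z - z + \tfrac12\log(2\pi) + \sum_{j=1}^{k-1}\widehat{T}_j(z) + \widehat{R}_k(z).$$ For real $t>0$, $\widetilde{R}_{k}(t) := \Im\left(\tfrac12\widehat{R}_{k}(it)\right)$. It is the remainder in the expansion $$\vartheta(t) = \frac{t}{2} \log\left(\frac{t}{2\pi e}\right) - \frac{\pi}{8} + \frac{\arctan(e^{-\pi t})}{2} + \sum_{j=1}^{k-1}\widetilde{T}_j(t) + \widetilde{R}_{k}(t),\qquad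 \widetilde{T}_j(t) := \frac{|B_{2j}(\frac12)|}{4j(2j-1)t^{2j-1}},$$ of the Riemann-Siegel theta function $\vartheta(t) = \arg\Gamma\left(\frac{it}{2}+\frac14\right) - \frac{t}{2}\log\pi$ (argument chosen so that $\vartheta$ is continuous on $\mathbb{R}$ with $\vartheta(0)=0$). *)

(* Defs.v *)
(* Stdlib reals with Coquelicot; the complex numbers are Coquelicot's [C]. *)
From Stdlib Require Import Reals Lra Lia Arith.
From Coquelicot Require Import Coquelicot.
Open Scope R_scope.

(* [bernoulli_upto n i] is the i-th Bernoulli number for i <= n. The recursion
   is B_0 = 1 and sum_(j <= n) binom(n+1, j) B_j = 0 for n >= 1, solved for B_n;
   see [bernoulli_rec]. In particular B_1 = -1/2. *)
Fixpoint bernoulli_upto (n : nat) : nat -> R :=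
  match n with
  | O => fun _ => 1
  | S m => fun i =>
      if (i <=? m)%nat then bernoulli_upto m i
      else - / INR (S n) *
           sum_f_R0 (fun j => Binomial.C (S n) j * bernoulli_upto m j) m
  end.

Definition bernoulli (n : nat) : R := bernoulli_upto n n.

Definition bernoulli_poly (n : nat) (u : R) : R :=
  sum_f_R0 (fun j => Binomial.C n j * bernoulli j * u ^ (n - j)) n.

Lemma bernoulli_upto_eq (n i : nat) :
  (i <= n)%nat -> bernoulli_upto n i = bernoulli i.
Proof.
  induction n as [|m IH]; intros Hi.
  - now replace i with 0%nat by lia.
  - destruct (Nat.eq_dec i (S m)) as [->|Hne]; [reflexivity|].
    simpl. destruct (Nat.leb_spec i m) as [_|Hlt]; [apply IH; lia|lia].
Qed.

Lemma bernoulli_rec (n : nat) :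
  (1 <= n)%nat -> sum_f_R0 (fun j => Binomial.C (S n) j * bernoulli j) n = 0.
Proof.
  destruct n as [|m]; [lia|intros _].
  rewrite tech5.
  unfold bernoulli at 2.
  cbn [bernoulli_upto].
  destruct (Nat.leb_spec (S m) m) as [Hlt|_]; [lia|].
  rewrite (sum_eq (fun j => Binomial.C (S (S m)) j * bernoulli_upto m j)
             (fun j => Binomial.C (S (S m)) j * bernoulli j) m)
    by (intros i Hi; now rewrite bernoulli_upto_eq).
  replace (Binomial.C (S (S m)) (S m)) with (INR (S (S m))).
  - field. apply not_0_INR; lia.
  - rewrite pascal_step2 by lia.
    rewrite pascal_step1 by lia.
    replace (S m - S m)%nat with 0%nat by lia.
    replace (S (S m) - S m)%nat with 1%nat by lia.
    rewrite C_n_0. simpl (INR 1). field.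
Qed.

Definition Cexp (z : C) : C := (exp (Re z) * cos (Im z), exp (Re z) * sin (Im z)).

(* Principal argument, in (-PI, PI]; meaningless at 0. *)
Definition Carg (z : C) : R :=
  if Rle_dec 0 (Im z) then acos (Re z / Cmod z) else - acos (Re z / Cmod z).

Definition Clog (z : C) : C := (ln (Cmod z), Carg z).

Definition slit_plane (z : C) : Prop := ~ (Im z = 0 /\ Re z <= 0).

Definition holomorphic_at (f : C -> C) (z : C) : Prop :=
  ex_derive (K := C_AbsRing) (V := AbsRing_NormedModule C_AbsRing) f z.

Fixpoint rising_prod (z : C) (n : nat) : C :=
  match n with
  | O => z
  | S m => Cmult (rising_prod z m) (Cplus z (RtoC (INR n)))
  end.

(* Euler's sequence n! n^z / (z (z+1) ... (z+n)). *)
Definition Gamma_seq (z : C) (n : nat) : C :=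
  Cdiv (Cmult (RtoC (INR (fact n))) (Cexp (Cmult z (RtoC (ln (INR n))))))
       (rising_prod z n).

(* The limit of Euler's sequence, which exists at every z other than the poles
   0, -1, -2, ...; limits are taken on real and imaginary parts. *)
Definition Gamma (z : C) : C :=
  (real (Lim_seq (fun n => Re (Gamma_seq z n))),
   real (Lim_seq (fun n => Im (Gamma_seq z n)))).

(* Holds of exactly one function on the slit plane: two candidates differ there
   by a continuous multiple of 2 i PI that vanishes on the positive reals. *)
Definition is_lnGamma (L : C -> C) : Prop :=
  (forall z : C, slit_plane z -> holomorphic_at L z) /\
  (forall z : C, slit_plane z -> Cexp (L z) = Gamma z) /\
  (forall x : R, 0 < x -> L (RtoC x) = RtoC (ln (Re (Gamma (RtoC x))))).

Definition That (j : nat) (z : C) : C :=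
  Cdiv (RtoC (bernoulli_poly (2 * j) (1 / 2)))
       (Cmult (RtoC (INR (2 * j) * INR (2 * j - 1))) (Cpow z (2 * j - 1))).

(* [sum_n_m] over 1 .. k-1 is empty for k = 1. *)
Definition Rhat (lnGamma : C -> C) (k : nat) (z : C) : C :=
  (lnGamma (z + RtoC (1 / 2))
   - (z * Clog z - z + RtoC (1 / 2 * ln (2 * PI))
      + sum_n_m (G := C_AbelianMonoid) (fun j => That j z) 1 (k - 1)))%C.

Definition Rtilde (lnGamma : C -> C) (k : nat) (t : R) : R :=
  Im (RtoC (1 / 2) * Rhat lnGamma k (Ci * RtoC t))%C.

(* Main.v *)
Require Import Defs.
From Stdlib Require Import Reals Lra Lia Arith.
From Coquelicot Require Import Coquelicot.
Open Scope R_scope.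

(** On the line Re z = 1/2, Euler's product shows that the argument of
    Gamma (1/2 + i s) is
      [phase s] = lim_N ( s ln N - sum_(m <= N) atan (s / (m + 1/2)) ).
    Any admissible lnGamma has imaginary part [phase s] there: both functions
    are continuous in s, vanish at s = 0, and agree modulo 2 PI
    ([Im_lnGamma_eq_phase]).

    Euler-Maclaurin summation at the midpoints m + 1/2, applied to the summand
    atan (t / x), turns this limit into t ln t - t plus exactly the imaginary
    parts of the terms [That j (i t)] for j <= k. The remainder is an integral
    of the 2k-th derivative of the summand against the periodic function
    B_{2k}(x) / (2k)!, and two sharp estimates bound it ([phase_expansion]).
    First, the Fourier series of the Bernoulli polynomials gives
      |B_n(x) / n!| <= 2 (2 PI)^-n (1 + 4 / 2^n)   on [0,1]  ([bern_abs_le]).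
    Second, the derivative is (2k-1)! times the imaginary part of
    (x + i t)^-2k up to sign, so it is at most (2k-1)! (x^2 + t^2)^-k, whose
    integral over x >= 0 is a Wallis integral. Together
      |Im Rhat_{k+1}(i t)| <=
        (1 + 4^(1-k)) 2 (2 PI)^-2k (2k-1)! t^(1-2k) W,
      W = PI/2 * 1/2 * 3/4 * ... * (2k-3)/(2k-2).

    The Stirling-type bound ((2k)! / (2^k k!))^2 <= 2 (2k/e)^2k turns the right
    side into
      (1 + 4^(1-k)) * 2p / (2k-1) * exp (2k ln (k/p) - 2k),   p = PI t.
    The exponent is stationary at k = p, with value -2p; a displacement of k
    by O(1) changes it by O(1/t) only, and the two prefactors are 1 + O(1/t)
    ([remainder_asymptotics]). This is the bound exp (-2 PI t) (1 + O(1/t)),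
    and the remainder in the statement is half of Im Rhat.

    No integral is formed: each estimate of an integral is carried by an
    explicit primitive and monotonicity. *)

(** * Elementary calculus *)

Lemma is_derive_sum_f_R0 (f d : nat -> R -> R) (n : nat) (x : R) :
  (forall j, (j <= n)%nat -> is_derive (f j) x (d j x)) ->
  is_derive (fun y => sum_f_R0 (fun j => f j y) n) x
    (sum_f_R0 (fun j => d j x) n).
Proof.
  induction n as [|n IH]; intros H; simpl.
  - apply H; lia.
  - apply (is_derive_plus (fun y => sum_f_R0 (fun j => f j y) n) (f (S n))).
    + apply IH. intros j Hj. apply H; lia.
    + apply H; lia.
Qed.

Lemma is_derive_eq (f : R -> R) (x l l' : R) :
  is_derive f x l -> l = l' -> is_derive f x l'.
Proof. now intros H <-. Qed.

Lemma mean_value (f df : R -> R) (a b : R) :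
  a <= b -> (forall x, a <= x <= b -> is_derive f x (df x)) ->
  exists c, a <= c <= b /\ f b - f a = df c * (b - a).
Proof.
  intros Hab H.
  destruct (MVT_gen f a b df) as [c Hc].
  - rewrite Rmin_left, Rmax_right by lra. intros x Hx; apply H; lra.
  - rewrite Rmin_left, Rmax_right by lra. intros x Hx.
    apply continuity_pt_filterlim, @ex_derive_continuous.
    exists (df x); apply H; lra.
  - rewrite Rmin_left, Rmax_right in Hc by lra. now exists c.
Qed.

(** The sign of the derivative is required in the open interval only: the
    Fejer kernel below is controlled through division by sin^2 (PI x), which
    vanishes at both ends of [0,1]. *)
Lemma increasing_of_derivative_nonneg (f df : R -> R) (a b : R) :
  a <= b -> (forall x, is_derive f x (df x)) ->
  (forall x, a < x < b -> 0 <= df x) -> f a <= f b.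
Proof.
  intros Hab Hd Hpos.
  destruct (Req_dec a b) as [<-|Hne]; [lra|].
  destruct (MVT_cor2 f df a b) as [c [Hc Hin]]; [lra| |].
  - intros c _. apply is_derive_Reals, Hd.
  - pose proof (Hpos c Hin). nra.
Qed.

(** The bound starts at n = 1, since C / INR 0 carries no information. *)
Lemma is_lim_seq_of_rate (u : nat -> R) (l C : R) :
  (forall n, (1 <= n)%nat -> Rabs (u n - l) <= C / INR n) -> is_lim_seq u l.
Proof.
  intros H.
  assert (H0 : is_lim_seq (fun n => C / INR n) 0).
  { replace (Finite 0) with (Rbar_mult C 0) by (simpl; f_equal; ring).
    apply is_lim_seq_scal_l.
    apply (is_lim_seq_inv INR p_infty); [apply is_lim_seq_INR|discriminate]. }
  assert (Hu : is_lim_seq (fun n => u n - l) 0).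
  { apply is_lim_seq_le_le_loc with (fun n => - (C / INR n)) (fun n => C / INR n).
    - exists 1%nat. intros n Hn. apply Rabs_le_between, H, Hn.
    - replace (Finite 0) with (Rbar_opp 0) by (simpl; f_equal; ring).
      now apply is_lim_seq_opp with (u := fun n => C / INR n).
    - exact H0. }
  apply is_lim_seq_ext with (fun n => (u n - l) + l); [intros; ring|].
  replace (Finite l) with (Finite (0 + l)) by (f_equal; ring).
  apply is_lim_seq_plus'; [exact Hu|apply is_lim_seq_const].
Qed.

Lemma ln_1_plus_le (x : R) : 0 <= x -> 0 <= ln (1 + x) <= x.
Proof.
  intros Hx. split.
  - rewrite <- ln_1. apply Rcomplements.ln_le; lra.
  - pose proof (exp_ineq1_le (ln (1 + x))). rewrite exp_ln in H by lra. lra.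
Qed.

Lemma exp_le_compat (a b : R) : a <= b -> exp a <= exp b.
Proof. intros [H | ->]; [left; now apply exp_increasing|apply Rle_refl]. Qed.

Lemma exp_le_linear (y : R) : 0 <= y <= 1 / 2 -> exp y <= 1 + 2 * y.
Proof.
  intros Hy. pose proof (exp_ineq1_le (- y)) as H. rewrite exp_Ropp in H.
  pose proof (exp_pos y) as He.
  assert (H1 : exp y * (1 - y) <= 1).
  { apply Rle_trans with (exp y * / exp y); [|right; field; lra].
    apply Rmult_le_compat_l; lra. }
  nra.
Qed.

Lemma atan_upper (y : R) : 0 <= y -> atan y <= y.
Proof.
  intros Hy.
  assert (H : 0 - atan 0 <= y - atan y).
  { apply (increasing_of_derivative_nonneg (fun x => x - atan x)
      (fun x => 1 - / (1 + x²))); [exact Hy| |].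
    - intros x. apply (is_derive_minus (fun x : R => x) atan x 1);
        [exact (is_derive_id x)|apply is_derive_atan].
    - intros x _. pose proof (Rle_0_sqr x).
      assert (/ (1 + x²) <= / 1) by (apply Rinv_le_contravar; lra). lra. }
  rewrite atan_0 in H. lra.
Qed.

(** The difference of the two sides vanishes at 0 and has derivative
    2 y^2 / (1 + y^2)^2. *)
Lemma atan_lower (y : R) : 0 <= y -> y / (1 + y ^ 2) <= atan y.
Proof.
  intros Hy.
  assert (H : atan 0 - 0 / (1 + 0 ^ 2) <= atan y - y / (1 + y ^ 2)).
  { apply (increasing_of_derivative_nonneg (fun x => atan x - x / (1 + x ^ 2))
      (fun x => 2 * x ^ 2 / (1 + x ^ 2) ^ 2)); [exact Hy| |].
    - intros x. assert (0 < 1 + x ^ 2) by nra.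
      apply is_derive_eq with (/ (1 + x²) - (1 - x ^ 2) / (1 + x ^ 2) ^ 2).
      + apply (is_derive_minus atan); [apply is_derive_atan|].
        auto_derive; [nra|]. field. nra.
      + unfold Rsqr. field. nra.
    - intros x _. apply Rdiv_le_0_compat; [nra|]. apply pow_lt; nra. }
  rewrite atan_0 in H. unfold Rdiv in *. lra.
Qed.

(** * Normalised Bernoulli polynomials *)

(** The normalisation by n! makes each polynomial the derivative of the next,
    which is all that Euler-Maclaurin summation and the Fourier argument use,
    apart from periodicity. *)
Definition bern (n : nat) (x : R) : R := bernoulli_poly n x / INR (fact n).

Lemma bern_expand (n : nat) (x : R) :
  bern n x = sum_f_R0 (fun j => bernoulli j / INR (fact j)
                               * (x ^ (n - j) / INR (fact (n - j)))) n.
Proof.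
  unfold bern, bernoulli_poly, Rdiv at 1. rewrite Rmult_comm, scal_sum.
  apply sum_eq; intros j Hj. unfold Binomial.C.
  field; repeat split; apply INR_fact_neq_0.
Qed.

Lemma bern_0 (x : R) : bern 0 x = 1.
Proof.
  unfold bern, bernoulli_poly, Binomial.C, bernoulli; simpl. field.
Qed.

Lemma bern_1 (x : R) : bern 1 x = x - 1 / 2.
Proof.
  unfold bern, bernoulli_poly, Binomial.C, bernoulli; simpl.
  unfold Binomial.C; simpl. field.
Qed.

Lemma is_derive_pow_div_fact (n : nat) (x : R) :
  is_derive (fun y => y ^ S n / INR (fact (S n))) x (x ^ n / INR (fact n)).
Proof.
  apply is_derive_ext with (fun y => / INR (fact (S n)) * y ^ S n).
  { intros y. apply Rmult_comm. }
  replace (x ^ n / INR (fact n))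
    with (/ INR (fact (S n)) * (INR (S n) * 1 * x ^ Nat.pred (S n))).
  - apply is_derive_scal, is_derive_pow, @is_derive_id.
  - rewrite fact_simpl, mult_INR. unfold Nat.pred.
    field. split; [apply INR_fact_neq_0|apply not_0_INR; lia].
Qed.

Lemma is_derive_bern (n : nat) (x : R) : is_derive (bern (S n)) x (bern n x).
Proof.
  apply is_derive_ext with
    (fun y => sum_f_R0 (fun j => bernoulli j / INR (fact j)
        * (y ^ (S n - j) / INR (fact (S n - j)))) n
      + bernoulli (S n) / INR (fact (S n))).
  { intros y. rewrite bern_expand, tech5, Nat.sub_diag.
    apply f_equal. change (y ^ 0) with 1. change (INR (fact 0)) with 1.
    field. apply INR_fact_neq_0. }
  rewrite bern_expand, <- (Rplus_0_r (sum_f_R0 _ n)).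
  apply (is_derive_plus (fun y => sum_f_R0 (fun j => bernoulli j / INR (fact j)
        * (y ^ (S n - j) / INR (fact (S n - j)))) n)); [|apply @is_derive_const].
  apply (is_derive_sum_f_R0 (fun j y => bernoulli j / INR (fact j)
        * (y ^ (S n - j) / INR (fact (S n - j)))) (fun j y => bernoulli j / INR (fact j)
        * (y ^ (n - j) / INR (fact (n - j))))).
  intros j Hj. apply is_derive_scal.
  replace (S n - j)%nat with (S (n - j)) by lia.
  apply is_derive_pow_div_fact.
Qed.

(** This is the recursion of the Bernoulli numbers, which says that the
    values at 0 and 1 of B_n agree for n >= 2. *)
Lemma bern_periodic (n : nat) : (2 <= n)%nat -> bern n 1 = bern n 0.
Proof.
  intros Hn. destruct n as [|m]; [lia|].
  unfold bern; f_equal. unfold bernoulli_poly. rewrite !tech5.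
  rewrite (sum_eq _ (fun j => Binomial.C (S m) j * bernoulli j) m)
    by (intros i Hi; rewrite pow1; ring).
  rewrite bernoulli_rec by lia.
  rewrite (sum_eq _ (fun _ => 0) m)
    by (intros i Hi; rewrite pow_i by lia; ring).
  rewrite sum_eq_R0 by reflexivity.
  rewrite Nat.sub_diag. simpl; ring.
Qed.

(** * Sup norm of the Bernoulli polynomials *)

(** The m-th term in the Fourier series of [bern n] on [0,1]. The phase shift
    by n PI / 2 makes these terms obey the same derivative relation as
    [bern]. *)
Definition harmonic (n m : nat) (x : R) : R :=
  - 2 * cos (2 * PI * INR m * x - INR n * (PI / 2)) / (2 * PI * INR m) ^ n.

(** Fejer means of the Fourier series are used rather than partial sums:
    the gap of index 0 is then the nonnegative Fejer kernel, so the gap of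
    index 1 is monotone, hence bounded by 1/2 uniformly in M. *)
Definition fejer_gap (M n : nat) (x : R) : R :=
  bern n x
  - sum_f_R0 (fun m => (1 - INR (S m) / INR (S M)) * harmonic n (S m) x) M.

Lemma two_PI_INR_pos (m : nat) : (1 <= m)%nat -> 0 < 2 * PI * INR m.
Proof.
  intros Hm. pose proof PI_RGT_0. apply Rmult_lt_0_compat; [lra|].
  apply lt_0_INR; lia.
Qed.

Lemma is_derive_harmonic (n m : nat) (x : R) :
  (1 <= m)%nat -> is_derive (harmonic (S n) m) x (harmonic n m x).
Proof.
  intros Hm. pose proof (two_PI_INR_pos m Hm) as Hp.
  pose proof (pow_lt _ n Hp). unfold harmonic. rewrite S_INR.
  set (w := 2 * PI * INR m) in *.
  replace ((INR n + 1) * (PI / 2)) with (INR n * (PI / 2) + PI / 2) by ring.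
  auto_derive; [trivial|].
  rewrite <- (cos_shift (_ + _)), <- (cos_neg (_ - _)).
  replace (- (PI / 2 - (w * x + - (INR n * (PI / 2) + PI / 2))))
    with (w * x - INR n * (PI / 2) - PI) by field.
  replace (cos (w * x - INR n * (PI / 2) - PI))
    with (- cos (w * x - INR n * (PI / 2)))
    by (rewrite (cos_minus _ PI), cos_PI, sin_PI; ring).
  change (w ^ S n) with (w * w ^ n).
  field. lra.
Qed.

Lemma is_derive_fejer_gap (M n : nat) (x : R) :
  is_derive (fejer_gap M (S n)) x (fejer_gap M n x).
Proof.
  apply (is_derive_minus (bern (S n))); [apply is_derive_bern|].
  apply (is_derive_sum_f_R0
    (fun m y => (1 - INR (S m) / INR (S M)) * harmonic (S n) (S m) y)
    (fun m y => (1 - INR (S m) / INR (S M)) * harmonic n (S m) y)).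
  intros j Hj. apply is_derive_scal, is_derive_harmonic. lia.
Qed.

Lemma fejer_gap_periodic (M n : nat) :
  (2 <= n)%nat -> fejer_gap M n 1 = fejer_gap M n 0.
Proof.
  intros Hn. unfold fejer_gap. f_equal; [now apply bern_periodic|].
  apply sum_eq; intros m Hm. unfold harmonic.
  rewrite <- (cos_period (2 * PI * INR (S m) * 0 - INR n * (PI / 2)) (S m)).
  do 4 f_equal. ring.
Qed.

(** Multiplied by sin y, the sum telescopes through
    2 cos p sin y = sin (p + y) - sin (p - y). *)
Lemma dirichlet_kernel (M : nat) (y : R) :
  (1 + 2 * sum_f_R0 (fun m => cos (2 * INR (S m) * y)) M) * sin y
  = sin ((2 * INR M + 3) * y).
Proof.
  assert (Hprod : forall p, 2 * cos p * sin y = sin (p + y) - sin (p - y))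
    by (intros p; rewrite sin_plus, sin_minus; ring).
  induction M as [|M IH].
  - simpl. rewrite Rmult_plus_distr_r, Hprod.
    replace (2 * 1 * y - y) with y by ring.
    replace ((2 * 0 + 3) * y) with (2 * 1 * y + y) by ring. ring.
  - rewrite tech5, Rmult_plus_distr_l, <- Rplus_assoc, Rmult_plus_distr_r, IH,
      Hprod.
    rewrite !S_INR.
    replace (2 * (INR M + 1 + 1) * y - y) with ((2 * INR M + 3) * y) by ring.
    replace (2 * (INR M + 1 + 1) * y + y)
      with ((2 * (INR M + 1) + 3) * y) by ring. ring.
Qed.

(** The Fejer sum of order M + 1 exceeds that of order M by a Dirichlet
    kernel, and sin^2 p grows in the same way. *)
Lemma fejer_kernel_sum (M : nat) (y : R) :
  (INR (S M) + 2 * sum_f_R0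
     (fun m => (INR (S M) - INR (S m)) * cos (2 * INR (S m) * y)) M) * sin y ^ 2
  = sin (INR (S M) * y) ^ 2.
Proof.
  induction M as [|M IH].
  - simpl. replace (1 * y) with y by ring. ring.
  - rewrite tech5.
    rewrite (sum_eq _ (fun m => (INR (S M) - INR (S m)) * cos (2 * INR (S m) * y)
        + cos (2 * INR (S m) * y)) M)
      by (intros i _; rewrite (S_INR (S M)); ring).
    rewrite sum_plus. rewrite (S_INR (S M)) at 1.
    match goal with |- (?a + 1 + 2 * (?s + ?d + ?z)) * _ = _ =>
      replace ((a + 1 + 2 * (s + d + z)) * sin y ^ 2)
        with ((a + 2 * s) * sin y ^ 2 + (1 + 2 * d) * sin y * sin y)
        by ring end.
    rewrite IH, dirichlet_kernel, !S_INR.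
    (* sin^2 q - sin^2 p = sin (p + q) sin (q - p) with q - p = y *)
    set (p := (INR M + 1) * y).
    replace ((INR M + 1 + 1) * y) with (p + y) by (unfold p; ring).
    set (q := p + y).
    replace ((2 * INR M + 3) * y) with (p + q) by (unfold q, p; ring).
    replace y with (q - p) by (unfold q; ring).
    rewrite sin_plus, sin_minus.
    pose proof (sin2_cos2 p) as Hp; pose proof (sin2_cos2 q) as Hq.
    unfold Rsqr in Hp, Hq.
    transitivity (sin p * sin p
      + sin q * sin q * (cos p * cos p) - cos q * cos q * (sin p * sin p)); [ring|].
    replace (cos p * cos p) with (1 - sin p * sin p) by lra.
    replace (cos q * cos q) with (1 - sin q * sin q) by lra. ring.
Qed.

(** The Fejer kernel in closed form. *)
Lemma fejer_gap_0 (M : nat) (x : R) :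
  INR (S M) * fejer_gap M 0 x * sin (PI * x) ^ 2
  = sin (INR (S M) * (PI * x)) ^ 2.
Proof.
  rewrite <- fejer_kernel_sum. f_equal. unfold fejer_gap. rewrite bern_0.
  assert (HN : INR (S M) <> 0) by (apply not_0_INR; lia).
  replace (sum_f_R0 (fun m => (1 - INR (S m) / INR (S M)) * harmonic 0 (S m) x) M)
    with (- 2 / INR (S M) * sum_f_R0
      (fun m => (INR (S M) - INR (S m)) * cos (2 * INR (S m) * (PI * x))) M).
  - field. exact HN.
  - rewrite scal_sum. apply sum_eq; intros m _. unfold harmonic.
    replace (2 * PI * INR (S m) * x - INR 0 * (PI / 2))
      with (2 * INR (S m) * (PI * x)) by (simpl (INR 0); ring).
    simpl pow. field. exact HN.
Qed.

Lemma sin_PI_pos (x : R) : 0 < x < 1 -> 0 < sin (PI * x).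
Proof.
  intros Hx. pose proof PI_RGT_0. apply sin_gt_0; nra.
Qed.

Lemma fejer_gap_0_nonneg (M : nat) (x : R) : 0 < x < 1 -> 0 <= fejer_gap M 0 x.
Proof.
  intros Hx. pose proof (sin_PI_pos x Hx) as Hs.
  pose proof (fejer_gap_0 M x) as H.
  assert (HN : 0 < INR (S M)) by (apply lt_0_INR; lia).
  assert (Hs2 : 0 < INR (S M) * sin (PI * x) ^ 2) by (apply Rmult_lt_0_compat; nra).
  pose proof (pow2_ge_0 (sin (INR (S M) * (PI * x)))).
  apply Rnot_lt_le; intros Hn. nra.
Qed.

Lemma fejer_gap_0_le (M : nat) (d x : R) :
  0 < d <= x -> x <= 1 / 2 ->
  fejer_gap M 0 x <= / (INR (S M) * sin (PI * d) ^ 2).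
Proof.
  intros Hd Hx. pose proof PI_RGT_0 as HPI.
  assert (Hsd : 0 < sin (PI * d)) by (apply sin_PI_pos; lra).
  assert (Hmon : sin (PI * d) <= sin (PI * x)) by (apply sin_incr_1; nra).
  pose proof (fejer_gap_0 M x) as H.
  assert (HN : 0 < INR (S M)) by (apply lt_0_INR; lia).
  assert (Hs : sin (INR (S M) * (PI * x)) ^ 2 <= 1).
  { pose proof (SIN_bound (INR (S M) * (PI * x))). nra. }
  assert (Hden : 0 < INR (S M) * sin (PI * d) ^ 2)
    by (apply Rmult_lt_0_compat; nra).
  apply Rmult_le_reg_r with (INR (S M) * sin (PI * d) ^ 2); [exact Hden|].
  rewrite Rinv_l by lra.
  pose proof (fejer_gap_0_nonneg M x ltac:(lra)) as Hnn.
  apply Rle_trans with (INR (S M) * fejer_gap M 0 x * sin (PI * x) ^ 2); [|lra].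
  replace (fejer_gap M 0 x * (INR (S M) * sin (PI * d) ^ 2))
    with (INR (S M) * fejer_gap M 0 x * sin (PI * d) ^ 2) by ring.
  apply Rmult_le_compat_l; [nra|]. apply pow_incr; lra.
Qed.

Lemma sin_nat_PI (m : nat) : sin (INR m * PI) = 0.
Proof. apply sin_eq_0_1. exists (Z.of_nat m). now rewrite INR_IZR_INZ. Qed.

(** At multiples of 1/2 the sine series of index 1 vanishes, which pins down
    the integration constant of the gap of index 1. *)
Lemma harmonic_1_at_half_integer (m h : nat) :
  harmonic 1 m (INR h / 2) = 0.
Proof.
  unfold harmonic.
  replace (2 * PI * INR m * (INR h / 2) - INR 1 * (PI / 2))
    with (- (PI / 2 - INR (m * h) * PI)) by (rewrite mult_INR; simpl; field).
  rewrite cos_neg, cos_shift, sin_nat_PI. unfold Rdiv; ring.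
Qed.

Lemma fejer_gap_1_at_half_integer (M h : nat) :
  fejer_gap M 1 (INR h / 2) = INR h / 2 - 1 / 2.
Proof.
  unfold fejer_gap. rewrite bern_1.
  rewrite (sum_eq _ (fun _ => 0) M)
    by (intros i _; rewrite harmonic_1_at_half_integer; ring).
  rewrite sum_eq_R0 by reflexivity. ring.
Qed.

Lemma fejer_gap_1_increasing (M : nat) (x y : R) :
  0 <= x <= y -> y <= 1 -> fejer_gap M 1 x <= fejer_gap M 1 y.
Proof.
  intros Hxy Hy.
  apply increasing_of_derivative_nonneg with (fejer_gap M 0); [lra| |].
  - apply is_derive_fejer_gap.
  - intros z Hz. apply fejer_gap_0_nonneg; lra.
Qed.

(** The gap of index 1 increases from -1/2 at 0 through 0 at 1/2. *)
Lemma fejer_gap_1_sign (M : nat) (x : R) :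
  (0 <= x <= 1 / 2 -> - (1 / 2) <= fejer_gap M 1 x <= 0)
  /\ (1 / 2 <= x <= 1 -> 0 <= fejer_gap M 1 x).
Proof.
  pose proof (fejer_gap_1_at_half_integer M 0) as H0.
  pose proof (fejer_gap_1_at_half_integer M 1) as H1.
  simpl in H0, H1.
  replace (0 / 2) with 0 in H0 by field.
  split; intros Hx.
  - pose proof (fejer_gap_1_increasing M 0 x).
    pose proof (fejer_gap_1_increasing M x (1 / 2)). lra.
  - pose proof (fejer_gap_1_increasing M (1 / 2) x). lra.
Qed.

(** The derivative is negative on the left half of [0,1] and positive on the
    right half, so the extreme values sit at 1/2 and at the ends. *)
Lemma fejer_gap_2_range (M : nat) (x : R) :
  0 <= x <= 1 -> fejer_gap M 2 (1 / 2) <= fejer_gap M 2 x <= fejer_gap M 2 0.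
Proof.
  intros Hx.
  assert (Hdec : forall u v, 0 <= u <= v -> v <= 1 / 2 ->
    fejer_gap M 2 v <= fejer_gap M 2 u).
  { intros u v Hu Hv.
    destruct (mean_value (fejer_gap M 2) (fejer_gap M 1) u v) as [c [Hc E]];
      [lra|intros; apply is_derive_fejer_gap|].
    pose proof (proj1 (fejer_gap_1_sign M c)). nra. }
  assert (Hinc : forall u v, 1 / 2 <= u <= v -> v <= 1 ->
    fejer_gap M 2 u <= fejer_gap M 2 v).
  { intros u v Hu Hv.
    destruct (mean_value (fejer_gap M 2) (fejer_gap M 1) u v) as [c [Hc E]];
      [lra|intros; apply is_derive_fejer_gap|].
    pose proof (proj2 (fejer_gap_1_sign M c)). nra. }
  pose proof (fejer_gap_periodic M 2 ltac:(lia)).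
  destruct (Rle_dec x (1 / 2)).
  - pose proof (Hdec 0 x). pose proof (Hdec x (1 / 2)). lra.
  - pose proof (Hinc (1 / 2) x). pose proof (Hinc x 1). lra.
Qed.

(** Rolle: the next gap takes equal values at 0 and 1. This replaces the
    statement that the gap has mean zero. *)
Lemma fejer_gap_zero (M n : nat) :
  (1 <= n)%nat -> exists c, 0 <= c <= 1 /\ fejer_gap M n c = 0.
Proof.
  intros Hn.
  destruct (mean_value (fejer_gap M (S n)) (fejer_gap M n) 0 1) as [c [Hc E]];
    [lra|intros; apply is_derive_fejer_gap|].
  exists c; split; [exact Hc|].
  rewrite fejer_gap_periodic in E by lia. lra.
Qed.

(** By [fejer_gap_2_range] and the existence of a zero, it is enough to bound
    the drop from 0 to 1/2. Near 0 the slope is at most 1/2, so a short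
    interval [0,d] contributes at most d/2. On [d,1/2] the slope is an integral
    of the Fejer kernel, which is O(1/M) there. *)
Lemma fejer_gap_2_small (eps : R) :
  0 < eps -> exists M, forall x, 0 <= x <= 1 -> Rabs (fejer_gap M 2 x) <= eps.
Proof.
  intros Heps. set (d := Rmin eps (1 / 4)).
  assert (Hd : 0 < d <= 1 / 4 /\ d <= eps).
  { unfold d. pose proof (Rmin_l eps (1 / 4)). pose proof (Rmin_r eps (1 / 4)).
    split; [split|]; try lra. apply Rmin_glb_lt; lra. }
  assert (Hs : 0 < sin (PI * d)) by (apply sin_PI_pos; lra).
  set (q := / (sin (PI * d) ^ 2)).
  assert (Hq : 0 < q) by (apply Rinv_0_lt_compat, pow_lt, Hs).
  destruct (INR_unbounded (q / eps)) as [M HM].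
  exists M. intros x Hx.
  assert (HN : 0 < INR (S M)) by (apply lt_0_INR; lia).
  assert (Hk : / (INR (S M) * sin (PI * d) ^ 2) <= eps).
  { rewrite Rinv_mult. fold q. apply Rmult_le_reg_l with (INR (S M)); [lra|].
    rewrite <- Rmult_assoc, Rinv_r, Rmult_1_l by lra.
    rewrite S_INR in *. apply (Rmult_lt_compat_r eps) in HM; [|lra].
    unfold Rdiv in HM. rewrite Rmult_assoc, Rinv_l in HM by lra. nra. }
  assert (Hosc : fejer_gap M 2 0 - fejer_gap M 2 (1 / 2) <= eps).
  { destruct (mean_value (fejer_gap M 2) (fejer_gap M 1) 0 d) as [c [Hc E]];
      [lra|intros; apply is_derive_fejer_gap|].
    pose proof (proj1 (fejer_gap_1_sign M c)).
    destruct (mean_value (fejer_gap M 2) (fejer_gap M 1) d (1 / 2)) as [e [He E']];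
      [lra|intros; apply is_derive_fejer_gap|].
    destruct (mean_value (fejer_gap M 1) (fejer_gap M 0) e (1 / 2)) as [a [Ha E'']];
      [lra|intros; apply is_derive_fejer_gap|].
    pose proof (fejer_gap_1_at_half_integer M 1) as H1. simpl in H1.
    pose proof (fejer_gap_0_le M d a).
    assert (fejer_gap M 1 e >= - (eps / 2)) by nra.
    nra. }
  destruct (fejer_gap_zero M 2) as [c [Hc Ec]]; [lia|].
  pose proof (fejer_gap_2_range M c Hc). pose proof (fejer_gap_2_range M x Hx).
  apply Rabs_le. lra.
Qed.

(** Each gap has a zero and its derivative is the preceding gap, so on an
    interval of length 1 the sup norm cannot grow with n. Uniform smallness
    thus passes from index 2 to every larger index, without any convergence
    argument for the individual series. *)
Lemma fejer_gap_le (M n : nat) (eps : R) :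
  (forall x, 0 <= x <= 1 -> Rabs (fejer_gap M 2 x) <= eps) -> (2 <= n)%nat ->
  forall x, 0 <= x <= 1 -> Rabs (fejer_gap M n x) <= eps.
Proof.
  intros H Hn. induction n as [|n IH]; [lia|].
  destruct (Nat.eq_dec n 1) as [->|Hne]; [exact H|].
  intros x Hx. destruct (fejer_gap_zero M (S n)) as [c [Hc Ec]]; [lia|].
  assert (Hdiff : forall u v, 0 <= u <= v -> v <= 1 ->
    Rabs (fejer_gap M (S n) v - fejer_gap M (S n) u) <= eps).
  { intros u v Hu Hv.
    destruct (mean_value (fejer_gap M (S n)) (fejer_gap M n) u v) as [e [He ->]];
      [lra|intros; apply is_derive_fejer_gap|].
    rewrite Rabs_mult, (Rabs_pos_eq (v - u)) by lra.
    pose proof (IH ltac:(lia) e ltac:(lra)).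
    pose proof (Rabs_pos (fejer_gap M n e)). nra. }
  destruct (Rle_dec c x).
  - pose proof (Hdiff c x ltac:(lra) ltac:(lra)) as Hd.
    now rewrite Ec, Rminus_0_r in Hd.
  - pose proof (Hdiff x c ltac:(lra) ltac:(lra)) as Hd.
    now rewrite Ec, Rminus_0_l, Rabs_Ropp in Hd.
Qed.

Lemma harmonic_abs_le (n m : nat) (x : R) :
  (1 <= m)%nat -> Rabs (harmonic n m x) <= 2 / (2 * PI) ^ n * / INR m ^ n.
Proof.
  intros Hm. pose proof PI_RGT_0.
  pose proof (lt_0_INR m ltac:(lia)) as Hm0.
  unfold harmonic. rewrite Rpow_mult_distr.
  pose proof (pow_lt _ n Hm0). pose proof (pow_lt (2 * PI) n ltac:(lra)).
  unfold Rdiv. rewrite Rinv_mult, !Rabs_mult.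
  rewrite (Rabs_pos_eq (/ _)) by (left; now apply Rinv_0_lt_compat).
  rewrite (Rabs_pos_eq (/ _)) by (left; now apply Rinv_0_lt_compat).
  replace (Rabs (-2)) with 2 by (rewrite Rabs_left; lra).
  rewrite <- Rmult_assoc.
  apply Rmult_le_compat_r; [left; now apply Rinv_0_lt_compat|].
  apply Rmult_le_compat_r; [left; now apply Rinv_0_lt_compat|].
  pose proof (COS_bound (2 * PI * INR m * x - INR n * (PI / 2))).
  pose proof (Rabs_le (cos (2 * PI * INR m * x - INR n * (PI / 2))) 1). lra.
Qed.

(** For m >= 2 one has m^-n <= 4 / 2^n * m^-2, and the sum of m^-2
    is dominated by the telescoping sum of 1 / (m (m-1)). *)
Lemma zeta_partial_sum_le (n M : nat) :
  (2 <= n)%nat ->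
  sum_f_R0 (fun m => / INR (S m) ^ n) M <= 1 + 4 / 2 ^ n * (1 - / INR (S M)).
Proof.
  intros Hn. pose proof (pow_lt 2 n ltac:(lra)) as H2n.
  induction M as [|M IH].
  - simpl. rewrite pow1. lra.
  - rewrite tech5. set (a := INR (S M)) in *. rewrite (S_INR (S M)). fold a.
    assert (Ha : 1 <= a) by (unfold a; rewrite S_INR; pose proof (pos_INR M); lra).
    assert (Hterm : / (a + 1) ^ n <= 4 / 2 ^ n * (/ (a * (a + 1)))).
    { (* (a+1)^n >= 2^(n-2) (a+1)^2 because a + 1 >= 2 *)
      assert (H : 2 ^ n * (a + 1) ^ 2 <= 4 * (a + 1) ^ n).
      { replace n with (n - 2 + 2)%nat by lia. rewrite !pow_add.
        assert (2 ^ (n - 2) <= (a + 1) ^ (n - 2)) by (apply pow_incr; lra).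
        pose proof (pow2_ge_0 (a + 1)). simpl (2 ^ 2). nra. }
      assert (0 < (a + 1) ^ n) by (apply pow_lt; lra).
      replace (4 / 2 ^ n * / (a * (a + 1))) with (/ (2 ^ n * (a * (a + 1)) / 4))
        by (field; lra).
      apply Rinv_le_contravar; [|nra].
      apply Rdiv_lt_0_compat; [|lra]. apply Rmult_lt_0_compat; nra. }
    assert (E : / (a * (a + 1)) = / a - / (a + 1)) by (field; lra).
    rewrite E in Hterm. lra.
Qed.

(** The constant 2 (2 PI)^-n is that of the first harmonic, and the higher
    ones contribute a relative correction of order 2^-n. A larger leading
    constant here would enlarge the coefficient of exp (-2 PI t) at the end. *)
Lemma bern_abs_le (n : nat) (x : R) :
  (2 <= n)%nat -> 0 <= x <= 1 ->
  Rabs (bern n x) <= 2 / (2 * PI) ^ n * (1 + 4 / 2 ^ n).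
Proof.
  intros Hn Hx. pose proof PI_RGT_0.
  pose proof (pow_lt (2 * PI) n ltac:(lra)) as Hpn.
  pose proof (pow_lt 2 n ltac:(lra)) as H2n.
  apply le_epsilon. intros eps Heps.
  destruct (fejer_gap_2_small eps Heps) as [M HM].
  pose proof (fejer_gap_le M n eps HM Hn x Hx) as Hgap.
  unfold fejer_gap in Hgap.
  set (s := sum_f_R0 _ M) in Hgap.
  assert (Hs : Rabs s <= 2 / (2 * PI) ^ n * (1 + 4 / 2 ^ n)).
  { unfold s. eapply Rle_trans; [apply Rsum_abs|].
    apply Rle_trans with
      (sum_f_R0 (fun m => / INR (S m) ^ n * (2 / (2 * PI) ^ n)) M).
    - apply sum_Rle; intros m Hm.
      rewrite Rabs_mult, (Rmult_comm (/ _)).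
      pose proof (harmonic_abs_le n (S m) x ltac:(lia)) as Hh.
      assert (HN : 0 < INR (S M)) by (apply lt_0_INR; lia).
      assert (Hw : 0 <= INR (S m) / INR (S M) <= 1).
      { split; [apply Rdiv_le_0_compat; [apply pos_INR|lra]|].
        apply Rmult_le_reg_r with (INR (S M)); [lra|].
        unfold Rdiv. rewrite Rmult_assoc, Rinv_l, Rmult_1_r, Rmult_1_l by lra.
        apply le_INR; lia. }
      rewrite (Rabs_pos_eq (1 - _)) by lra.
      pose proof (Rabs_pos (harmonic n (S m) x)). nra.
    - rewrite <- scal_sum. apply Rmult_le_compat_l.
      + apply Rdiv_le_0_compat; lra.
      + eapply Rle_trans; [apply zeta_partial_sum_le, Hn|].
        assert (0 < / INR (S M)) by (apply Rinv_0_lt_compat, lt_0_INR; lia).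
        assert (0 < 4 / 2 ^ n) by (apply Rdiv_lt_0_compat; lra). nra. }
  pose proof (Rabs_triang (bern n x - s) s) as Ht.
  replace (bern n x - s + s) with (bern n x) in Ht by ring. lra.
Qed.

(** * Midpoint Euler-Maclaurin summation *)

(** The combination left at one end of a unit interval by repeated
    integration by parts of g_0 against the Bernoulli polynomials, when
    g_0, g_1, ... are successive derivatives. *)
Definition em_sum (g : nat -> R -> R) (p : nat) (c y : R) : R :=
  sum_f_R0 (fun i => (-1) ^ i * bern (S i) y * g i (c + y)) p.

(** Since bern' (n+1) = bern n, the derivative telescopes: only the summand
    g_0 and the highest term survive. This is Euler-Maclaurin summation in
    differential form. *)
Lemma is_derive_em_sum (g : nat -> R -> R) (p : nat) (c y : R) :
  (forall j x, is_derive (g j) x (g (S j) x)) ->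
  is_derive (em_sum g p c) y
    (g 0%nat (c + y) + (-1) ^ p * bern (S p) y * g (S p) (c + y)).
Proof.
  intros Hg.
  replace (g 0%nat (c + y) + (-1) ^ p * bern (S p) y * g (S p) (c + y)) with
    (sum_f_R0 (fun i => (-1) ^ i *
       (bern i y * g i (c + y) + bern (S i) y * g (S i) (c + y))) p).
  - apply (is_derive_sum_f_R0 (fun i z => (-1) ^ i * bern (S i) z * g i (c + z))
      (fun i z => (-1) ^ i *
         (bern i z * g i (c + z) + bern (S i) z * g (S i) (c + z)))).
    intros i _. apply is_derive_ext with
      (fun z => (-1) ^ i * (bern (S i) z * g i (c + z)));
      [intros; symmetry; apply Rmult_assoc|].
    apply is_derive_scal.
    apply (is_derive_mult (bern (S i)) (fun z => g i (c + z)) y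
             (bern i y) (g (S i) (c + y))).
    + apply is_derive_bern.
    + replace (g (S i) (c + y)) with (scal 1 (g (S i) (c + y)))
        by apply Rmult_1_l.
      apply (is_derive_comp (g i) (fun z => c + z)); [apply Hg|].
      auto_derive; [trivial|ring].
    + intros; apply Rmult_comm.
  - induction p as [|p IH].
    + simpl. rewrite bern_0. ring.
    + rewrite tech5, IH. simpl. ring.
Qed.

(** The part of [em_sum] without the trapezoidal term. It takes equal values
    at y = 0 and y = 1, so it telescopes over consecutive unit intervals. *)
Definition em_tail (g : nat -> R -> R) (q : nat) (x y : R) : R :=
  sum_f_R0 (fun i => (-1) ^ S i * bern (S (S i)) y * g (S i) x) q.

Lemma em_sum_split (g : nat -> R -> R) (q : nat) (c y : R) :
  em_sum g (S q) c y
  = (y - 1 / 2) * g 0%nat (c + y) + em_tail g q (c + y) y.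
Proof.
  unfold em_sum, em_tail. rewrite decomp_sum by lia. rewrite bern_1.
  simpl Nat.pred. ring.
Qed.

Lemma em_tail_periodic (g : nat -> R -> R) (q : nat) (x : R) :
  em_tail g q x 1 = em_tail g q x 0.
Proof.
  unfold em_tail. apply sum_eq; intros i _. now rewrite bern_periodic by lia.
Qed.

(** The function h stands for a bound of the highest derivative and H for its
    primitive. By [is_derive_em_sum], B H minus or plus the error is
    nondecreasing, which is the integral estimate without the integral. *)
Lemma euler_maclaurin_interval (g : nat -> R -> R) (G H h : R -> R) (q : nat)
    (B c u v : R) :
  (forall j x, is_derive (g j) x (g (S j) x)) ->
  (forall x, is_derive G x (g 0%nat x)) ->
  (forall x, is_derive H x (h x)) ->
  (forall x, Rabs (g (S (S q)) x) <= h x) ->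
  (forall y, 0 <= y <= 1 -> Rabs (bern (S (S q)) y) <= B) ->
  0 <= u <= v -> v <= 1 ->
  Rabs (em_sum g (S q) c v - em_sum g (S q) c u - (G (c + v) - G (c + u)))
  <= B * (H (c + v) - H (c + u)).
Proof.
  intros Hg HG HH Hh HB Hu Hv.
  assert (Hshift : forall (f : R -> R) y l, is_derive f (c + y) l ->
    is_derive (fun z => f (c + z)) y l).
  { intros f y l Hf. replace l with (scal 1 l) by apply Rmult_1_l.
    apply (is_derive_comp f (fun z => c + z)); [exact Hf|].
    auto_derive; [trivial|ring]. }
  assert (Hone : forall s, Rabs s = 1 ->
    B * H (c + u) - s * (em_sum g (S q) c u - G (c + u))
    <= B * H (c + v) - s * (em_sum g (S q) c v - G (c + v))).
  { intros s Hs.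
    apply (increasing_of_derivative_nonneg
      (fun z => B * H (c + z) - s * (em_sum g (S q) c z - G (c + z)))
      (fun z => B * h (c + z)
         - s * (g 0%nat (c + z)
                + (-1) ^ S q * bern (S (S q)) z * g (S (S q)) (c + z)
                - g 0%nat (c + z)))); [lra| |].
    - intros y. apply (is_derive_minus (fun z => B * H (c + z))).
      + apply is_derive_scal, (Hshift H), HH.
      + apply is_derive_scal, (is_derive_minus (em_sum g (S q) c)).
        * apply is_derive_em_sum, Hg.
        * apply (Hshift G), HG.
    - intros y Hy.
      replace (g 0%nat (c + y)
                + (-1) ^ S q * bern (S (S q)) y * g (S (S q)) (c + y)
                - g 0%nat (c + y))
        with ((-1) ^ S q * bern (S (S q)) y * g (S (S q)) (c + y)) by ring.
      pose proof (Rle_abs (s * ((-1) ^ S q * bern (S (S q)) y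
                                  * g (S (S q)) (c + y)))) as Ha.
      rewrite !Rabs_mult, Hs, pow_1_abs in Ha.
      apply -> Rminus_le_0. eapply Rle_trans; [exact Ha|].
      rewrite !Rmult_1_l.
      apply Rmult_le_compat; auto using Rabs_pos with real.
      apply HB; lra. }
  pose proof (Hone 1 (Rabs_R1)).
  pose proof (Hone (-1) ltac:(rewrite Rabs_left; lra)).
  apply Rabs_le. lra.
Qed.

(** The unit intervals are centred at integers, with a half interval
    [0,1/2] at the start, so that the nodes are the points m + 1/2. The starting half
    interval produces the values of the Bernoulli polynomials at 1/2. *)
Lemma euler_maclaurin_midpoint (g : nat -> R -> R) (G H h : R -> R) (q : nat)
    (B : R) (N : nat) :
  (forall j x, is_derive (g j) x (g (S j) x)) ->
  (forall x, is_derive G x (g 0%nat x)) ->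
  (forall x, is_derive H x (h x)) ->
  (forall x, Rabs (g (S (S q)) x) <= h x) ->
  (forall y, 0 <= y <= 1 -> Rabs (bern (S (S q)) y) <= B) ->
  Rabs (sum_f_R0 (fun m => g 0%nat (INR m + 1 / 2)) N
        - 1 / 2 * g 0%nat (INR N + 1 / 2)
        + em_tail g q (INR N + 1 / 2) 0 - em_tail g q 0 (1 / 2)
        - (G (INR N + 1 / 2) - G 0))
  <= B * (H (INR N + 1 / 2) - H 0).
Proof.
  intros Hg HG HH Hh HB. induction N as [|N IH].
  - pose proof (euler_maclaurin_interval g G H h q B (- (1 / 2)) (1 / 2) 1
      Hg HG HH Hh HB ltac:(lra) ltac:(lra)) as E.
    rewrite !em_sum_split in E.
    replace (- (1 / 2) + 1) with (INR 0 + 1 / 2) in E by (simpl; lra).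
    replace (- (1 / 2) + 1 / 2) with 0 in E by lra.
    rewrite em_tail_periodic in E. cbn [sum_f_R0].
    match goal with |- Rabs ?x <= _ => match type of E with Rabs ?y <= _ =>
      replace x with y by lra end end. exact E.
  - pose proof (euler_maclaurin_interval g G H h q B (INR N + 1 / 2) 0 1
      Hg HG HH Hh HB ltac:(lra) ltac:(lra)) as E.
    rewrite !em_sum_split in E.
    replace (INR N + 1 / 2 + 1) with (INR (S N) + 1 / 2) in E
      by (rewrite S_INR; lra).
    rewrite Rplus_0_r, em_tail_periodic in E. rewrite tech5.
    match type of E with Rabs ?y <= _ => match type of IH with Rabs ?z <= _ =>
      pose proof (Rabs_triang z y) as Ht';
      match goal with |- Rabs ?x <= _ => replace x with (z + y) by lra end end end.
    lra.
Qed.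

(** * The arctangent summand and its derivatives *)

(** Real and imaginary part of d/dx (x + i t)^-j = - j (x + i t)^-(j+1). *)
Lemma is_derive_inv_pow (t : R) (j : nat) (x : R) :
  0 < t ->
  is_derive (fun y => Re (Cpow (/ (y, t)) j)) x
    (- INR j * Re (Cpow (/ (x, t)) (S j)))
  /\ is_derive (fun y => Im (Cpow (/ (y, t)) j)) x
    (- INR j * Im (Cpow (/ (x, t)) (S j))).
Proof.
  intros Ht. induction j as [|j [IHr IHi]].
  - change (INR 0) with 0. rewrite Ropp_0, !Rmult_0_l. split.
    + exact (@is_derive_const R_AbsRing R_NormedModule 1 x).
    + exact (@is_derive_const R_AbsRing R_NormedModule 0 x).
  - assert (Hw : 0 < x ^ 2 + t ^ 2) by nra.
    assert (Dr : is_derive (fun y => y / (y ^ 2 + t ^ 2)) x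
              ((t ^ 2 - x ^ 2) / (x ^ 2 + t ^ 2) ^ 2)).
    { auto_derive; [nra|]. field. nra. }
    assert (Di : is_derive (fun y => - t / (y ^ 2 + t ^ 2)) x
              (2 * t * x / (x ^ 2 + t ^ 2) ^ 2)).
    { auto_derive; [nra|]. field. nra. }
    assert (Hr : forall y, Re (Cpow (/ (y, t)) (S j))
       = y / (y ^ 2 + t ^ 2) * Re (Cpow (/ (y, t)) j)
         - - t / (y ^ 2 + t ^ 2) * Im (Cpow (/ (y, t)) j)) by reflexivity.
    assert (Hi : forall y, Im (Cpow (/ (y, t)) (S j))
       = y / (y ^ 2 + t ^ 2) * Im (Cpow (/ (y, t)) j)
         + - t / (y ^ 2 + t ^ 2) * Re (Cpow (/ (y, t)) j)) by reflexivity.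
    rewrite (Cpow_S _ (S j)).
    replace (Re (/ (x, t) * Cpow (/ (x, t)) (S j))%C)
      with (x / (x ^ 2 + t ^ 2) * Re (Cpow (/ (x, t)) (S j))
            - - t / (x ^ 2 + t ^ 2) * Im (Cpow (/ (x, t)) (S j))) by reflexivity.
    replace (Im (/ (x, t) * Cpow (/ (x, t)) (S j))%C)
      with (x / (x ^ 2 + t ^ 2) * Im (Cpow (/ (x, t)) (S j))
            + - t / (x ^ 2 + t ^ 2) * Re (Cpow (/ (x, t)) (S j))) by reflexivity.
    rewrite S_INR.
    pose proof (fun f g a b Hf Hg => is_derive_mult f g x a b Hf Hg Rmult_comm)
      as Dmult.
    split.
    + eapply is_derive_ext; [intros y; symmetry; apply Hr|].
      eapply is_derive_eq.
      * apply @is_derive_minus; [apply (Dmult _ _ _ _ Dr IHr)|apply (Dmult _ _ _ _ Di IHi)].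
      * rewrite (Hr x), (Hi x). unfold minus, plus, opp, mult; simpl.
        set (p := Re (Cpow (/ (x, t)) j)). set (q := Im (Cpow (/ (x, t)) j)).
        field. nra.
    + eapply is_derive_ext; [intros y; symmetry; apply Hi|].
      eapply is_derive_eq.
      * apply @is_derive_plus; [apply (Dmult _ _ _ _ Dr IHi)|apply (Dmult _ _ _ _ Di IHr)].
      * rewrite (Hr x), (Hi x). unfold minus, plus, opp, mult; simpl.
        set (p := Re (Cpow (/ (x, t)) j)). set (q := Im (Cpow (/ (x, t)) j)).
        field. nra.
Qed.

(** The successive x-derivatives of atan (t / x). The form
    PI/2 - atan (x / t) of the function itself is smooth at x = 0, where
    the expansion starts. *)
Definition angle_deriv (t : R) (j : nat) (x : R) : R :=
  match j with
  | O => PI / 2 - atan (x / t)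
  | S i => (-1) ^ i * INR (fact i) * Im (Cpow (/ (x, t)) (S i))
  end.

Lemma is_derive_angle_deriv (t : R) (j : nat) (x : R) :
  0 < t -> is_derive (angle_deriv t j) x (angle_deriv t (S j) x).
Proof.
  intros Ht. destruct j as [|i].
  - assert (0 < x ^ 2 + t ^ 2) by nra.
    apply is_derive_eq with (- (/ t * / (1 + (x / t)²))).
    + assert (D : is_derive (fun y => atan (y / t)) x (/ t * / (1 + (x / t)²))).
      { apply (is_derive_comp atan (fun y => y / t)); [apply is_derive_atan|].
        auto_derive; [trivial|field; lra]. }
      apply is_derive_eq with (0 - / t * / (1 + (x / t)²)); [|ring].
      apply (is_derive_minus (fun _ => PI / 2)); [|exact D].
      exact (@is_derive_const R_AbsRing R_NormedModule (PI / 2) x).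
    + unfold angle_deriv, Rsqr. simpl. field. lra.
  - unfold angle_deriv.
    apply is_derive_eq with ((-1) ^ i * INR (fact i)
      * (- INR (S i) * Im (Cpow (/ (x, t)) (S (S i))))).
    + apply is_derive_scal, is_derive_inv_pow, Ht.
    + rewrite fact_simpl, mult_INR. change ((-1) ^ S i) with (-1 * (-1) ^ i). ring.
Qed.

Lemma angle_deriv_0_eq (t x : R) :
  0 < t -> 0 < x -> angle_deriv t 0 x = atan (t / x).
Proof.
  intros Ht Hx. unfold angle_deriv. rewrite <- atan_inv by (apply Rdiv_lt_0_compat; lra).
  f_equal. field. lra.
Qed.

Lemma angle_deriv_S_abs_le (t : R) (i : nat) (x : R) :
  0 < t ->
  Rabs (angle_deriv t (S i) x) <= INR (fact i) * (/ sqrt (x ^ 2 + t ^ 2)) ^ S i.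
Proof.
  intros Ht. assert (Hw : 0 < x ^ 2 + t ^ 2) by nra.
  unfold angle_deriv. rewrite !Rabs_mult, pow_1_abs, Rmult_1_l.
  rewrite (Rabs_pos_eq (INR _)) by apply pos_INR.
  apply Rmult_le_compat_l; [apply pos_INR|].
  eapply Rle_trans; [eapply Rle_trans; [apply Rmax_r|apply Rmax_Cmod]|].
  rewrite Cmod_pow, Cmod_inv; [apply Rle_refl|].
  intros E. injection E; lra.
Qed.

(** The primitive of (1 + x^2)^-(l+1) that vanishes at 0, by the usual
    reduction formula; [wallis_half l] is its limit at infinity. *)
Fixpoint inv_sq_primitive (l : nat) (x : R) : R :=
  match l with
  | O => atan x
  | S i => x / (2 * INR l * (1 + x ^ 2) ^ l)
           + (2 * INR l - 1) / (2 * INR l) * inv_sq_primitive i x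
  end.

Fixpoint wallis_half (l : nat) : R :=
  match l with
  | O => PI / 2
  | S i => (2 * INR l - 1) / (2 * INR l) * wallis_half i
  end.

Lemma is_derive_inv_sq_primitive (l : nat) (x : R) :
  is_derive (inv_sq_primitive l) x (/ (1 + x ^ 2) ^ S l).
Proof.
  assert (Hw : 0 < 1 + x ^ 2) by nra.
  induction l as [|l IH].
  - eapply is_derive_eq; [apply is_derive_atan|]. unfold Rsqr. simpl. f_equal. ring.
  - assert (Hl : 0 < INR (S l)) by (apply lt_0_INR; lia).
    pose proof (pow_lt _ l Hw) as Hp.
    assert (D : is_derive (fun y => y / (2 * INR (S l) * (1 + y ^ 2) ^ S l)) x
      (/ (2 * INR (S l) * (1 + x ^ 2) ^ S l) - x ^ 2 / (1 + x ^ 2) ^ S (S l))).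
    { assert (D0 : is_derive (fun y => (1 + y ^ 2) ^ S l) x
          (INR (S l) * (2 * x) * (1 + x ^ 2) ^ l)).
      { apply (is_derive_pow (fun y => 1 + y ^ 2) (S l)). auto_derive; [trivial|ring]. }
      eapply is_derive_eq.
      - apply (is_derive_div (fun y => y) (fun y => 2 * INR (S l) * (1 + y ^ 2) ^ S l)).
        + apply @is_derive_id.
        + apply is_derive_scal, D0.
        + pose proof (pow_lt _ (S l) Hw). nra.
      - cbn [pow] in *. unfold one; simpl.
        set (P := (1 + x * (x * 1)) ^ l) in *.
        change (match l with O => 1 | S _ => INR l + 1 end) with (INR (S l)).
        field. repeat split; lra. }
    eapply is_derive_eq.
    + apply (is_derive_plus (fun y => y / (2 * INR (S l) * (1 + y ^ 2) ^ S l))).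
      * exact D.
      * apply is_derive_scal, IH.
    + unfold plus; simpl.
      change (match l with O => 1 | S _ => INR l + 1 end) with (INR (S l)).
      cbn [pow] in Hw, Hp. set (P := (1 + x * (x * 1)) ^ l) in *.
      field. repeat split; lra.
Qed.

(** The boundary terms of the reduction formula add up to at most l / y.
    They tend to 0, but are positive, so the sharp bound does not follow by
    induction alone. *)
Lemma inv_sq_primitive_le_aux (l : nat) (y : R) :
  1 <= y -> inv_sq_primitive l y <= wallis_half l + INR l / y.
Proof.
  intros Hy. induction l as [|l IH].
  - simpl. pose proof (atan_bound y). unfold Rdiv at 2. lra.
  - cbn [inv_sq_primitive wallis_half]. rewrite S_INR. pose proof (pos_INR l) as Hl.
    assert (H1 : y / (2 * (INR l + 1) * (1 + y ^ 2) ^ S l) <= / y).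
    { replace (/ y) with (y / (y ^ 2)) by (field; lra).
      apply Rmult_le_compat_l; [lra|]. apply Rinv_le_contravar; [nra|].
      assert (1 <= (1 + y ^ 2) ^ l) by (apply pow_R1_Rle; nra).
      cbn [pow].
      assert (1 + y * (y * 1) <= (1 + y * (y * 1)) * (1 + y ^ 2) ^ l) by nra.
      cbn [pow] in *. nra. }
    assert (H2 : 0 < (2 * (INR l + 1) - 1) / (2 * (INR l + 1)) <= 1).
    { split; [apply Rdiv_lt_0_compat; lra|].
      apply Rmult_le_reg_r with (2 * (INR l + 1)); [lra|].
      unfold Rdiv. rewrite Rmult_assoc, Rinv_l; lra. }
    replace ((INR l + 1) / y) with (INR l / y + / y) by (field; lra).
    assert (0 <= INR l / y) by (apply Rdiv_le_0_compat; lra).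
    set (r := (2 * (INR l + 1) - 1) / (2 * (INR l + 1))) in *.
    assert (r * inv_sq_primitive l y <= r * (wallis_half l + INR l / y))
      by (apply Rmult_le_compat_l; lra).
    nra.
Qed.

(** The primitive increases, so the bound at large arguments with an
    arbitrarily small error holds everywhere without error. *)
Lemma inv_sq_primitive_le (l : nat) (x : R) :
  inv_sq_primitive l x <= wallis_half l.
Proof.
  apply le_epsilon. intros eps Heps.
  set (y := Rmax 1 (Rmax x (INR l / eps))).
  assert (Hy : 1 <= y /\ x <= y /\ INR l / eps <= y).
  { unfold y. repeat split.
    - apply Rmax_l.
    - eapply Rle_trans; [apply Rmax_l|apply Rmax_r].
    - eapply Rle_trans; [apply Rmax_r|apply Rmax_r]. }
  destruct Hy as [H1 [H2 H3]].
  apply Rle_trans with (inv_sq_primitive l y).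
  - apply (increasing_of_derivative_nonneg _ (fun z => / (1 + z ^ 2) ^ S l));
      [exact H2|apply is_derive_inv_sq_primitive|].
    intros z _. left. apply Rinv_0_lt_compat, pow_lt. nra.
  - eapply Rle_trans; [apply inv_sq_primitive_le_aux, H1|].
    apply Rplus_le_compat_l.
    apply Rmult_le_reg_r with y; [lra|]. unfold Rdiv.
    rewrite Rmult_assoc, Rinv_l, Rmult_1_r by lra.
    apply (Rmult_le_compat_r eps) in H3; [|lra].
    unfold Rdiv in H3. rewrite Rmult_assoc, Rinv_l in H3 by lra. lra.
Qed.

(** * Asymptotic expansion of the phase *)

Lemma angle_deriv_lim (t : R) (i : nat) :
  0 < t -> is_lim_seq (fun N => angle_deriv t (S i) (INR N + 1 / 2)) 0.
Proof.
  intros Ht. apply is_lim_seq_of_rate with (INR (fact i)). intros n Hn.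
  rewrite Rminus_0_r. eapply Rle_trans; [apply angle_deriv_S_abs_le, Ht|].
  assert (Hn1 : 1 <= INR n) by (apply (le_INR 1); lia).
  apply Rmult_le_compat_l; [apply pos_INR|].
  set (x := INR n + 1 / 2).
  assert (Hs : INR n <= sqrt (x ^ 2 + t ^ 2)).
  { apply Rsqr_incr_0_var; [|apply sqrt_pos].
    rewrite Rsqr_sqrt by nra. unfold Rsqr, x. nra. }
  rewrite pow_inv. apply Rinv_le_contravar; [lra|].
  assert (1 <= sqrt (x ^ 2 + t ^ 2) ^ i) by (apply pow_R1_Rle; lra).
  change (sqrt (x ^ 2 + t ^ 2) ^ S i)
    with (sqrt (x ^ 2 + t ^ 2) * sqrt (x ^ 2 + t ^ 2) ^ i). nra.
Qed.

Lemma atan_div_lim (t : R) :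
  0 < t -> is_lim_seq (fun N => atan (t / (INR N + 1 / 2))) 0.
Proof.
  intros Ht. apply is_lim_seq_of_rate with t. intros n Hn.
  assert (Hn1 : 1 <= INR n) by (apply (le_INR 1); lia).
  assert (Hy : 0 <= t / (INR n + 1 / 2)) by (apply Rdiv_le_0_compat; lra).
  pose proof (atan_upper _ Hy). pose proof (atan_lower _ Hy).
  assert (0 <= t / (INR n + 1 / 2) / (1 + (t / (INR n + 1 / 2)) ^ 2))
    by (apply Rdiv_le_0_compat; nra).
  rewrite Rminus_0_r, Rabs_pos_eq by lra.
  apply Rle_trans with (t / (INR n + 1 / 2)); [lra|].
  apply Rmult_le_compat_l; [lra|]. apply Rinv_le_contravar; lra.
Qed.

Definition angle_primitive (t x : R) : R :=
  x * angle_deriv t 0 x + t / 2 * ln (x ^ 2 + t ^ 2).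

Lemma is_derive_angle_primitive (t x : R) :
  0 < t -> is_derive (angle_primitive t) x (angle_deriv t 0 x).
Proof.
  intros Ht. assert (Hw : 0 < x ^ 2 + t ^ 2) by nra.
  assert (E : angle_deriv t 1 x = - t / (x ^ 2 + t ^ 2))
    by (simpl; field; nra).
  apply is_derive_eq with
    (angle_deriv t 0 x + x * angle_deriv t 1 x + t / 2 * (2 * x / (x ^ 2 + t ^ 2))).
  - apply (is_derive_plus (fun y => y * angle_deriv t 0 y)).
    + apply is_derive_eq with (1 * angle_deriv t 0 x + x * angle_deriv t 1 x); [|ring].
      apply (is_derive_mult (fun y => y) (angle_deriv t 0));
        [apply @is_derive_id|apply is_derive_angle_deriv, Ht|apply Rmult_comm].
    + apply is_derive_scal. auto_derive; [exact Hw|]. field. nra.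
  - rewrite E. field. nra.
Qed.

(** At x = N + 1/2 the first term x atan (t/x) tends to t, and the logarithm
    contributes t ln N. *)
Lemma angle_primitive_lim (t : R) :
  0 < t ->
  is_lim_seq (fun N => angle_primitive t (INR N + 1 / 2) - t * ln (INR N)) t.
Proof.
  intros Ht. apply is_lim_seq_of_rate with (t ^ 3 + t / 2 * (2 + t ^ 2)). intros n Hn.
  assert (Hn1 : 1 <= INR n) by (apply (le_INR 1); lia).
  unfold angle_primitive. set (a := INR n) in *. set (x := a + 1 / 2).
  assert (Hx : a <= x) by (unfold x; lra).
  rewrite angle_deriv_0_eq by lra.
  assert (Hy : 0 <= t / x) by (apply Rdiv_le_0_compat; lra).
  assert (Hinv : 0 < / a) by (apply Rinv_0_lt_compat; lra).
  (* x atan (t/x) = t + O(1/n) *)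
  assert (H1 : t - t ^ 3 / a <= x * atan (t / x) <= t).
  { split.
    - apply Rle_trans with (x * (t / x / (1 + (t / x) ^ 2))).
      + replace (x * (t / x / (1 + (t / x) ^ 2))) with (t - t ^ 3 * / (x ^ 2 + t ^ 2))
          by (field; repeat split; nra).
        assert (/ (x ^ 2 + t ^ 2) <= / a) by (apply Rinv_le_contravar; nra).
        assert (0 < t ^ 3) by (apply pow_lt; lra). unfold Rdiv. nra.
      + apply Rmult_le_compat_l; [lra|]. now apply atan_lower.
    - apply Rle_trans with (x * (t / x)); [|right; field; lra].
      apply Rmult_le_compat_l; [lra|]. now apply atan_upper. }
  (* ln (x^2 + t^2) = 2 ln n + O(1/n) *)
  assert (H2 : 0 <= ln (x ^ 2 + t ^ 2) - 2 * ln a <= (2 + t ^ 2) / a).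
  { set (e := (a + 1 / 4 + t ^ 2) / a ^ 2).
    assert (He : 0 <= e) by (apply Rdiv_le_0_compat; nra).
    replace (x ^ 2 + t ^ 2) with (a * a * (1 + e))
      by (unfold e, x; field; lra).
    rewrite !ln_mult by nra.
    pose proof (ln_1_plus_le e He).
    assert (e <= (2 + t ^ 2) / a).
    { unfold e. apply Rmult_le_reg_r with (a ^ 2); [nra|].
      replace ((a + 1 / 4 + t ^ 2) / a ^ 2 * a ^ 2) with (a + 1 / 4 + t ^ 2)
        by (field; lra).
      replace ((2 + t ^ 2) / a * a ^ 2) with ((2 + t ^ 2) * a) by (field; lra).
      nra. }
    lra. }
  replace ((t ^ 3 + t / 2 * (2 + t ^ 2)) / a)
    with (t ^ 3 / a + t / 2 * ((2 + t ^ 2) / a)) by (field; lra).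
  assert (0 <= t ^ 3 / a)
    by (apply Rdiv_le_0_compat; [apply pow_le; lra|lra]).
  assert (0 <= (2 + t ^ 2) / a) by (apply Rdiv_le_0_compat; nra).
  apply Rabs_le. split; nra.
Qed.

Lemma em_tail_lim (t : R) (q : nat) :
  0 < t -> is_lim_seq (fun N => em_tail (angle_deriv t) q (INR N + 1 / 2) 0) 0.
Proof.
  intros Ht. unfold em_tail.
  assert (Hone : forall i, is_lim_seq (fun N => (-1) ^ S i * bern (S (S i)) 0
     * angle_deriv t (S i) (INR N + 1 / 2)) 0).
  { intros i.
    replace (Finite 0) with (Rbar_mult ((-1) ^ S i * bern (S (S i)) 0) 0)
      by (simpl; f_equal; ring).
    apply is_lim_seq_scal_l, angle_deriv_lim, Ht. }
  induction q as [|q IH].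
  - apply Hone.
  - replace (Finite 0) with (Finite (0 + 0)) by (f_equal; ring).
    apply (is_lim_seq_plus' _ _ _ _ IH (Hone (S q))).
Qed.

(** An even power of 1 / (i t) is real, so only the Bernoulli polynomials of
    even index occur in the expansion. *)
Lemma Im_pow_even (t : R) (l : nat) :
  0 < t -> Im (Cpow (/ (0, t)) (2 * l)) = 0.
Proof.
  intros Ht. rewrite Cpow_mult_r.
  replace (Cpow (/ (0, t)) 2) with (RtoC (- / t ^ 2)).
  - now rewrite <- RtoC_pow.
  - unfold RtoC, Cinv, Cpow, Cmult; simpl. f_equal; field; lra.
Qed.

(** The odd derivatives of atan (t / x) at x = 0 are multiples of the
    imaginary parts of (i t)^-(2j+1). *)
Lemma Im_That (t : R) (j : nat) :
  0 < t ->
  Im (That (S j) (Ci * RtoC t))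
  = bern (S (S (2 * j))) (1 / 2) * angle_deriv t (S (2 * j)) 0.
Proof.
  intros Ht. unfold That, angle_deriv.
  replace (2 * S j - 1)%nat with (S (2 * j)) by lia.
  replace (2 * S j)%nat with (S (S (2 * j))) by lia.
  replace (Ci * RtoC t)%C with ((0, t) : C)
    by (unfold Ci, RtoC, Cmult; simpl; f_equal; ring).
  assert (Hz : ((0, t) : C) <> 0) by (intros E; injection E; lra).
  rewrite Cpow_inv by exact Hz.
  pose proof (Cpow_nz _ (S (2 * j)) Hz) as Hp.
  set (p := Cpow (0, t) (S (2 * j))) in *.
  rewrite pow_1_even.
  assert (Hd : INR (S (S (2 * j))) * INR (S (2 * j)) <> 0)
    by (apply Rgt_not_eq, Rmult_lt_0_compat; apply lt_0_INR; lia).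
  assert (Hscal : forall (a : R) (z : C), Im (RtoC a * z) = a * Im z)
    by (intros a [u v]; unfold Im, RtoC, Cmult; simpl; ring).
  unfold bern. rewrite !fact_simpl, !mult_INR.
  replace (Cdiv (RtoC (bernoulli_poly (S (S (2 * j))) (1 / 2)))
     (RtoC (INR (S (S (2 * j))) * INR (S (2 * j))) * p))
    with (RtoC (bernoulli_poly (S (S (2 * j))) (1 / 2)
           / (INR (S (S (2 * j))) * INR (S (2 * j)))) * / p)%C.
  - rewrite Hscal. field. repeat split; try apply INR_fact_neq_0; apply not_0_INR; lia.
  - rewrite RtoC_div. 2: exact Hd.
    field. split; [exact Hp|]. intros E. apply Hd. now apply RtoC_inj.
Qed.

(** The boundary terms at x = 0 are exactly the terms of the asymptotic
    series. *)
Lemma em_tail_at_0 (t : R) (l : nat) :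
  0 < t ->
  em_tail (angle_deriv t) (2 * l) 0 (1 / 2)
  = - Im (sum_n_m (G := C_AbelianMonoid) (fun j => That j (Ci * RtoC t)) 1 (S l)).
Proof.
  intros Ht. induction l as [|l IH].
  - rewrite sum_n_n, Im_That by exact Ht. unfold em_tail. simpl. ring.
  - rewrite sum_n_Sm by lia.
    replace (Im _) with
      (Im (sum_n_m (G := C_AbelianMonoid) (fun j => That j (Ci * RtoC t)) 1 (S l))
       + Im (That (S (S l)) (Ci * RtoC t))) by reflexivity.
    rewrite Ropp_plus_distr, <- IH, Im_That by exact Ht.
    unfold em_tail. replace (2 * S l)%nat with (S (S (2 * l))) by lia.
    rewrite !tech5.
    replace (angle_deriv t (S (S (2 * l))) 0) with 0.
    + replace ((-1) ^ S (S (S (2 * l)))) with (-1).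
      * ring.
      * replace (S (S (S (2 * l)))) with (S (2 * S l)) by lia. now rewrite pow_1_odd.
    + unfold angle_deriv. replace (S (S (2 * l))) with (2 * S l)%nat by lia.
      rewrite Im_pow_even by exact Ht. ring.
Qed.

(** Stated with k = l + 1 terms, using the derivative of order 2k = 2l + 2.
    In the midpoint formula all boundary terms at N + 1/2 vanish in the limit,
    and the error bound is uniform in N. *)
Lemma phase_expansion (t phi : R) (l : nat) :
  0 < t ->
  is_lim_seq (fun N => t * ln (INR N)
     - sum_f_R0 (fun m => atan (t / (INR m + 1 / 2))) N) phi ->
  Rabs (phi - (t * ln t - t
     + Im (sum_n_m (G := C_AbelianMonoid) (fun j => That j (Ci * RtoC t)) 1 (S l))))
  <= 2 / (2 * PI) ^ S (S (2 * l)) * (1 + 4 / 2 ^ S (S (2 * l)))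
     * (INR (fact (S (2 * l))) / t ^ S (2 * l) * wallis_half l).
Proof.
  intros Ht Hphi.
  set (B := 2 / (2 * PI) ^ S (S (2 * l)) * (1 + 4 / 2 ^ S (S (2 * l)))).
  assert (HB : forall y, 0 <= y <= 1 -> Rabs (bern (S (S (2 * l))) y) <= B)
    by (intros y Hy; apply bern_abs_le; [lia|exact Hy]).
  assert (HB0 : 0 <= B) by (eapply Rle_trans; [apply Rabs_pos|apply (HB 0); lra]).
  set (cst := INR (fact (S (2 * l))) / t ^ S (2 * l)).
  assert (Htp : 0 < t ^ S (2 * l)) by now apply pow_lt.
  assert (Hcst : 0 < cst) by (apply Rdiv_lt_0_compat; [apply INR_fact_lt_0|exact Htp]).
  set (H := fun x => cst * inv_sq_primitive l (x / t)).
  set (h := fun x => INR (fact (S (2 * l))) / (x ^ 2 + t ^ 2) ^ S l).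
  assert (HH : forall x, is_derive H x (h x)).
  { intros x. assert (Hw : 0 < x ^ 2 + t ^ 2) by nra.
    apply is_derive_eq with (cst * (/ t * / (1 + (x / t) ^ 2) ^ S l)).
    - apply is_derive_scal.
      apply (is_derive_comp (inv_sq_primitive l) (fun x => x / t)).
      + apply is_derive_inv_sq_primitive.
      + auto_derive; [trivial|field; lra].
    - unfold cst, h.
      replace (1 + (x / t) ^ 2) with ((x ^ 2 + t ^ 2) / t ^ 2) by (field; lra).
      unfold Rdiv at 2. rewrite Rpow_mult_distr, pow_inv, <- pow_mult.
      replace (2 * S l)%nat with (S (S (2 * l))) by lia.
      change (t ^ S (S (2 * l))) with (t * t ^ S (2 * l)).
      pose proof (pow_lt _ (S l) Hw). field. lra. }
  assert (Hh : forall x, Rabs (angle_deriv t (S (S (2 * l))) x) <= h x).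
  { intros x. eapply Rle_trans; [apply angle_deriv_S_abs_le, Ht|].
    assert (Hw : 0 < x ^ 2 + t ^ 2) by nra.
    right. unfold h, Rdiv. f_equal.
    replace (S (S (2 * l))) with (2 * S l)%nat by lia.
    rewrite pow_mult, pow_inv, pow_inv, pow2_sqrt by lra. reflexivity. }
  assert (HE : forall N,
    Rabs (sum_f_R0 (fun m => angle_deriv t 0 (INR m + 1 / 2)) N
        - 1 / 2 * angle_deriv t 0 (INR N + 1 / 2)
        + em_tail (angle_deriv t) (2 * l) (INR N + 1 / 2) 0
        - em_tail (angle_deriv t) (2 * l) 0 (1 / 2)
        - (angle_primitive t (INR N + 1 / 2) - angle_primitive t 0))
    <= B * (cst * wallis_half l)).
  { intros N. eapply Rle_trans.
    - apply (euler_maclaurin_midpoint _ _ H h).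
      + intros j x. now apply is_derive_angle_deriv.
      + intros x. now apply is_derive_angle_primitive.
      + exact HH.
      + exact Hh.
      + exact HB.
    - apply Rmult_le_compat_l; [exact HB0|].
      unfold H. rewrite <- Rmult_minus_distr_l.
      apply Rmult_le_compat_l; [lra|].
      assert (E0 : inv_sq_primitive l (0 / t) = 0).
      { replace (0 / t) with 0 by (field; lra). clear.
        induction l as [|l IH]; [apply atan_0|]. cbn [inv_sq_primitive].
        rewrite IH. unfold Rdiv. ring. }
      pose proof (inv_sq_primitive_le l ((INR N + 1 / 2) / t)). lra. }
  assert (HG0 : angle_primitive t 0 = t * ln t).
  { unfold angle_primitive. replace (0 ^ 2 + t ^ 2) with (t * t) by ring.
    rewrite ln_mult by lra. field. }
  set (S0 := em_tail (angle_deriv t) (2 * l) 0 (1 / 2)) in *.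
  assert (HL : is_lim_seq (fun N => sum_f_R0 (fun m => angle_deriv t 0 (INR m + 1 / 2)) N
        - 1 / 2 * angle_deriv t 0 (INR N + 1 / 2)
        + em_tail (angle_deriv t) (2 * l) (INR N + 1 / 2) 0
        - S0
        - (angle_primitive t (INR N + 1 / 2) - angle_primitive t 0))
     (- phi - 1 / 2 * 0 + 0 - t - (S0 - t * ln t))).
  { apply is_lim_seq_ext with (fun N =>
      - (t * ln (INR N) - sum_f_R0 (fun m => atan (t / (INR m + 1 / 2))) N)
      - 1 / 2 * atan (t / (INR N + 1 / 2))
      + em_tail (angle_deriv t) (2 * l) (INR N + 1 / 2) 0
      - (angle_primitive t (INR N + 1 / 2) - t * ln (INR N)) - (S0 - t * ln t)).
    - intros N. rewrite HG0.
      rewrite (angle_deriv_0_eq t (INR N + 1 / 2)) by (pose proof (pos_INR N); lra).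
      rewrite (sum_eq (fun m => angle_deriv t 0 (INR m + 1 / 2))
                (fun m => atan (t / (INR m + 1 / 2))) N)
        by (intros i _; apply angle_deriv_0_eq; pose proof (pos_INR i); lra).
      ring.
    - apply is_lim_seq_minus'; [|apply is_lim_seq_const].
      apply is_lim_seq_minus'; [|now apply angle_primitive_lim].
      apply is_lim_seq_plus'; [|now apply em_tail_lim].
      apply is_lim_seq_minus'.
      + apply (is_lim_seq_opp _ phi), Hphi.
      + apply (is_lim_seq_scal_l _ (1 / 2) 0), atan_div_lim, Ht. }
  apply is_lim_seq_abs in HL.
  pose proof (is_lim_seq_le _ _ _ _ HE HL (is_lim_seq_const _)) as Hfin.
  simpl in Hfin. unfold S0 in Hfin. rewrite em_tail_at_0 in Hfin by exact Ht.
  rewrite <- Rabs_Ropp.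
  match type of Hfin with Rabs ?x <= _ => match goal with |- Rabs ?y <= _ =>
    replace y with x by lra end end.
  exact Hfin.
Qed.

(** * The phase of Gamma on the line Re z = 1/2 *)

(** The argument of the N-th term of Euler's sequence at 1/2 + i s, chosen
    continuously in s. *)
Definition phase_seq (s : R) (N : nat) : R :=
  s * ln (INR N) - sum_f_R0 (fun m => atan (s / (INR m + 1 / 2))) N.

(** The derivative of [phase_seq] in s. It increases in N by summable steps,
    which yields both the convergence of the phase and a Lipschitz bound
    uniform in N. *)
Definition phase_deriv (s : R) (N : nat) : R :=
  ln (INR N)
  - sum_f_R0 (fun m => (INR m + 1 / 2) / ((INR m + 1 / 2) ^ 2 + s ^ 2)) N.

Lemma is_derive_phase_seq (N : nat) (s : R) :
  is_derive (fun s => phase_seq s N) s (phase_deriv s N).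
Proof.
  unfold phase_seq, phase_deriv.
  apply (is_derive_minus (fun s => s * ln (INR N))).
  - auto_derive; [trivial|ring].
  - apply (is_derive_sum_f_R0 (fun m s => atan (s / (INR m + 1 / 2)))
      (fun m s => (INR m + 1 / 2) / ((INR m + 1 / 2) ^ 2 + s ^ 2))).
    intros j _. pose proof (pos_INR j). set (x := INR j + 1 / 2).
    assert (Hx : 0 < x) by (unfold x; lra).
    apply is_derive_eq with (/ x * / (1 + (s / x)²)).
    + apply (is_derive_comp atan (fun s => s / x)); [apply is_derive_atan|].
      auto_derive; [trivial|field; lra].
    + unfold Rsqr. field. nra.
Qed.

(** The step is ln (1 + 1/N) - x / (x^2 + s^2) with x = N + 3/2, and both
    terms are 1/N + O(1/N^2). *)
Lemma phase_deriv_step (s : R) (n : nat) :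
  0 <= phase_deriv s (S (S n)) - phase_deriv s (S n)
    <= (2 + s ^ 2) * (/ INR (S n) - / INR (S (S n))).
Proof.
  unfold phase_deriv. rewrite tech5, (S_INR (S n)).
  set (N := INR (S n)). set (x := N + 1 + 1 / 2).
  assert (HN : 1 <= N) by (unfold N; rewrite S_INR; pose proof (pos_INR n); lra).
  replace (ln (N + 1) - (sum_f_R0 _ (S n) + x / (x ^ 2 + s ^ 2)) - _)
    with (ln (N + 1) - ln N - x / (x ^ 2 + s ^ 2)) by ring.
  assert (Hl1 : ln (N + 1) - ln N <= / N).
  { replace (N + 1) with (N * (1 + / N)) by (field; lra).
    assert (0 < / N) by (apply Rinv_0_lt_compat; lra).
    rewrite ln_mult by lra. pose proof (ln_1_plus_le (/ N)). lra. }
  assert (Hl2 : / (N + 1) <= ln (N + 1) - ln N).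
  { pose proof (exp_ineq1_le (ln N - ln (N + 1))) as He.
    unfold Rminus in He. rewrite exp_plus, exp_Ropp, !exp_ln in He by lra.
    change (N * / (N + 1)) with (N / (N + 1)) in He.
    replace (N / (N + 1)) with (1 - / (N + 1)) in He by (field; lra). lra. }
  assert (Hx : N + 1 <= x <= N + 2) by (unfold x; lra).
  assert (Hx1 : x / (x ^ 2 + s ^ 2) <= / (N + 1)).
  { apply Rle_trans with (/ x); [|apply Rinv_le_contravar; lra].
    replace (/ x) with (x / (x ^ 2)) by (field; lra).
    apply Rmult_le_compat_l; [lra|]. apply Rinv_le_contravar; nra. }
  assert (Hx2 : / N - x / (x ^ 2 + s ^ 2) <= (2 + s ^ 2) * (/ N - / (N + 1))).
  { replace (/ N - / (N + 1)) with (/ (N * (N + 1))) by (field; lra).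
    replace (/ N - x / (x ^ 2 + s ^ 2))
      with ((x - N) * / (N * x) + s ^ 2 * / (x * (x ^ 2 + s ^ 2)))
      by (field; repeat split; nra).
    assert (/ (N * x) <= / (N * (N + 1))) by (apply Rinv_le_contravar; nra).
    assert (/ (x * (x ^ 2 + s ^ 2)) <= / (N * (N + 1))).
    { apply Rinv_le_contravar; [nra|].
      apply Rmult_le_compat; nra. }
    assert (0 < / (N * (N + 1))) by (apply Rinv_0_lt_compat; nra).
    pose proof (pow2_ge_0 s). nra. }
  lra.
Qed.

Lemma phase_deriv_bound (s : R) (n : nat) :
  - 3 <= phase_deriv s (S n) <= 2 + s ^ 2.
Proof.
  assert (H : - 3 <= phase_deriv s (S n) <= (2 + s ^ 2) * (1 - / INR (S n))).
  { induction n as [|n IH].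
    - unfold phase_deriv. cbn [sum_f_R0]. change (INR 1) with 1.
      change (INR 0) with 0. rewrite ln_1, Rinv_1.
      assert (H : forall x, 0 < x -> 0 <= x / (x ^ 2 + s ^ 2) <= / x).
      { intros x Hx. split; [apply Rdiv_le_0_compat; nra|].
        replace (/ x) with (x / (x ^ 2)) by (field; lra).
        apply Rmult_le_compat_l; [lra|]. apply Rinv_le_contravar; nra. }
      pose proof (H (0 + 1 / 2) ltac:(lra)). pose proof (H (1 + 1 / 2) ltac:(lra)). lra.
    - pose proof (phase_deriv_step s n). lra. }
  assert (0 < / INR (S n)) by (apply Rinv_0_lt_compat, lt_0_INR; lia). nra.
Qed.

Lemma phase_seq_lipschitz (A u v : R) (n : nat) :
  - A <= u <= v -> v <= A ->
  Rabs (phase_seq v (S n) - phase_seq u (S n)) <= (3 + A ^ 2) * (v - u).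
Proof.
  intros Hu Hv.
  destruct (mean_value (fun s => phase_seq s (S n)) (fun s => phase_deriv s (S n)) u v)
    as [c [Hc ->]]; [lra|intros; apply is_derive_phase_seq|].
  rewrite Rabs_mult, (Rabs_pos_eq (v - u)) by lra.
  apply Rmult_le_compat_r; [lra|].
  pose proof (phase_deriv_bound c n). apply Rabs_le. nra.
Qed.

Lemma phase_seq_at_0 (N : nat) : phase_seq 0 N = 0.
Proof.
  unfold phase_seq. rewrite (sum_eq _ (fun _ => 0) N).
  - rewrite sum_eq_R0 by reflexivity. ring.
  - intros i _. unfold Rdiv. rewrite Rmult_0_l. apply atan_0.
Qed.

Lemma phase_seq_opp (s : R) (N : nat) : phase_seq (- s) N = - phase_seq s N.
Proof.
  unfold phase_seq.
  rewrite (sum_eq _ (fun m => atan (s / (INR m + 1 / 2)) * -1) N).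
  - rewrite <- scal_sum. ring.
  - intros i _. unfold Rdiv. rewrite Ropp_mult_distr_l_reverse, atan_opp. ring.
Qed.

(** For s >= 0 the sequence is increasing because its s-derivative is, and
    it is bounded by the Lipschitz estimate. *)
Lemma phase_seq_ex_lim_nonneg (s : R) : 0 <= s -> ex_finite_lim_seq (phase_seq s).
Proof.
  intros Hs.
  enough (ex_finite_lim_seq (fun n => phase_seq s (S n))) as [l Hl]
    by (exists l; apply is_lim_seq_incr_1, Hl).
  apply ex_finite_lim_seq_incr with ((3 + s ^ 2) * s).
  - intros n.
    assert (H : phase_seq 0 (S (S n)) - phase_seq 0 (S n)
                <= phase_seq s (S (S n)) - phase_seq s (S n)).
    { apply (increasing_of_derivative_nonneg
        (fun s => phase_seq s (S (S n)) - phase_seq s (S n))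
        (fun s => phase_deriv s (S (S n)) - phase_deriv s (S n))); [exact Hs| |].
      - intros x. apply (is_derive_minus (fun s => phase_seq s (S (S n))));
          apply is_derive_phase_seq.
      - intros x _. apply phase_deriv_step. }
    rewrite !phase_seq_at_0 in H. lra.
  - intros n. pose proof (phase_seq_lipschitz s 0 s n ltac:(lra) ltac:(lra)) as H.
    rewrite phase_seq_at_0, !Rminus_0_r in H.
    eapply Rle_trans; [apply Rle_abs|exact H].
Qed.

Definition phase (s : R) : R := real (Lim_seq (phase_seq s)).

Lemma phase_seq_lim (s : R) : is_lim_seq (phase_seq s) (phase s).
Proof.
  apply Lim_seq_correct'. destruct (Rle_dec 0 s) as [Hs|Hs].
  - now apply phase_seq_ex_lim_nonneg.
  - destruct (phase_seq_ex_lim_nonneg (- s)) as [l Hl]; [lra|].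
    exists (- l). apply is_lim_seq_ext with (fun n => - phase_seq (- s) n).
    + intros n. rewrite phase_seq_opp. ring.
    + apply (is_lim_seq_opp _ l), Hl.
Qed.

Lemma phase_at_0 : phase 0 = 0.
Proof.
  unfold phase. rewrite (Lim_seq_ext _ (fun _ => 0)) by apply phase_seq_at_0.
  now rewrite Lim_seq_const.
Qed.

Lemma phase_lipschitz (A u v : R) :
  - A <= u <= v -> v <= A -> Rabs (phase v - phase u) <= (3 + A ^ 2) * (v - u).
Proof.
  intros Hu Hv.
  pose proof (is_lim_seq_minus' _ _ _ _ (phase_seq_lim v) (phase_seq_lim u)) as H.
  apply is_lim_seq_incr_1, is_lim_seq_abs in H.
  apply (is_lim_seq_le _ _ _ _
    (fun n => phase_seq_lipschitz A u v n Hu Hv) H (is_lim_seq_const _)).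
Qed.

Lemma phase_continuous (s : R) : continuity_pt phase s.
Proof.
  intros eps Heps. set (A := Rabs s + 1).
  assert (HA : 0 < 3 + A ^ 2) by nra.
  exists (Rmin 1 (eps / (3 + A ^ 2))). split.
  - apply Rmin_glb_lt; [lra|apply Rdiv_lt_0_compat; lra].
  - intros x [_ Hx]. simpl in *. unfold Rdist in *.
    pose proof (Rlt_le_trans _ _ _ Hx (Rmin_l _ _)) as H1.
    pose proof (Rlt_le_trans _ _ _ Hx (Rmin_r _ _)) as H2.
    apply (Rmult_lt_compat_r (3 + A ^ 2)) in H2; [|lra].
    unfold Rdiv in H2. rewrite Rmult_assoc, Rinv_l in H2 by lra.
    assert (Hs : - A + 1 <= s <= A - 1)
      by (unfold A; pose proof (Rle_abs s); pose proof (Rle_abs (- s)) as Ha;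
          rewrite Rabs_Ropp in Ha; lra).
    apply Rabs_lt_between in H1.
    destruct (Rle_dec s x).
    + pose proof (phase_lipschitz A s x ltac:(lra) ltac:(lra)).
      rewrite Rabs_pos_eq in H2 by lra. lra.
    + pose proof (phase_lipschitz A x s ltac:(lra) ltac:(lra)) as H.
      rewrite Rabs_minus_sym. rewrite Rabs_minus_sym, Rabs_pos_eq in H2 by lra. lra.
Qed.

Definition cis (a : R) : C := (cos a, sin a).

Lemma cis_plus (a b : R) : (cis a * cis b)%C = cis (a + b).
Proof.
  unfold cis, Cmult; simpl. rewrite cos_plus, sin_plus. f_equal; ring.
Qed.

(** The arctangent is an argument of x + i s because x > 0. *)
Lemma cis_polar (x s : R) :
  0 < x -> ((x, s) : C) = (RtoC (sqrt (x ^ 2 + s ^ 2)) * cis (atan (s / x)))%C.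
Proof.
  intros Hx. unfold cis, RtoC, Cmult; simpl.
  rewrite cos_atan, sin_atan.
  assert (Hr : sqrt (x * (x * 1) + s * (s * 1)) = x * sqrt (1 + (s / x)²)).
  { replace (x * (x * 1) + s * (s * 1)) with (x ^ 2 * (1 + (s / x)²))
      by (unfold Rsqr; field; lra).
    pose proof (Rle_0_sqr (s / x)). rewrite sqrt_mult, sqrt_pow2 by nra. reflexivity. }
  rewrite Hr.
  assert (0 < sqrt (1 + (s / x)²))
    by (apply sqrt_lt_R0; pose proof (Rle_0_sqr (s / x)); lra).
  f_equal; field; lra.
Qed.

Lemma prod_shifted_squares_pos (s : R) (N : nat) :
  0 < prod_f_R0 (fun m => (INR m + 1 / 2) ^ 2 + s ^ 2) N.
Proof.
  induction N as [|N IH].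
  - simpl. nra.
  - cbn [prod_f_R0]. apply Rmult_lt_0_compat; [exact IH|].
    pose proof (pos_INR (S N)). nra.
Qed.

Lemma rising_prod_polar (s : R) (N : nat) :
  rising_prod (1 / 2, s) N
  = Cmult (RtoC (sqrt (prod_f_R0 (fun m => (INR m + 1 / 2) ^ 2 + s ^ 2) N)))
      (cis (sum_f_R0 (fun m => atan (s / (INR m + 1 / 2))) N)).
Proof.
  assert (Hpos : forall n, 0 <= prod_f_R0 (fun m => (INR m + 1 / 2) ^ 2 + s ^ 2) n)
    by (intros n; left; apply prod_shifted_squares_pos).
  induction N as [|N IH].
  - simpl rising_prod. simpl prod_f_R0. simpl sum_f_R0.
    rewrite (cis_polar (1 / 2) s) by lra. rewrite !Rplus_0_l. reflexivity.
  - cbn [rising_prod prod_f_R0 sum_f_R0]. rewrite IH.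
    replace (Cplus (1 / 2, s) (RtoC (INR (S N)))) with ((INR (S N) + 1 / 2, s) : C)
      by (unfold Cplus, RtoC; cbn [fst snd]; f_equal; ring).
    pose proof (pos_INR (S N)).
    rewrite (cis_polar (INR (S N) + 1 / 2)) by lra.
    rewrite <- cis_plus, sqrt_mult by (apply Hpos || nra).
    rewrite RtoC_mult. ring.
Qed.

Definition modulus_seq (s : R) (N : nat) : R :=
  INR (fact N) * exp (1 / 2 * ln (INR N))
  / sqrt (prod_f_R0 (fun m => (INR m + 1 / 2) ^ 2 + s ^ 2) N).

Lemma Gamma_seq_polar (s : R) (N : nat) :
  Gamma_seq (1 / 2, s) N = (RtoC (modulus_seq s N) * cis (phase_seq s N))%C.
Proof.
  unfold Gamma_seq, modulus_seq, phase_seq. rewrite rising_prod_polar.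
  pose proof (sqrt_lt_R0 _ (prod_shifted_squares_pos s N)) as Hr.
  set (r := sqrt _) in *. set (th := sum_f_R0 _ N).
  replace (Cexp (((1 / 2)%R, s) * RtoC (ln (INR N)))%C)
    with (RtoC (exp (1 / 2 * ln (INR N))) * cis (s * ln (INR N)))%C.
  2: { unfold Cexp, cis, RtoC, Cmult; simpl.
       replace (1 / 2 * ln (INR N) - s * 0) with (1 / 2 * ln (INR N)) by ring.
       replace (1 / 2 * 0 + s * ln (INR N)) with (s * ln (INR N)) by ring.
       f_equal; ring. }
  replace (s * ln (INR N) - th) with (s * ln (INR N) + - th) by ring.
  rewrite <- cis_plus, RtoC_div, RtoC_mult by lra.
  assert (Hc : (cis th * cis (- th))%C = 1)
    by (rewrite cis_plus, Rplus_opp_r; unfold cis; now rewrite cos_0, sin_0).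
  assert (Hth : cis th <> 0).
  { intros E. rewrite E, Cmult_0_l in Hc. injection Hc; lra. }
  assert (Hrc : RtoC r <> 0) by (intros E; apply RtoC_inj in E; lra).
  replace (cis (- th)) with (/ cis th)%C.
  - field. now split.
  - rewrite <- (Cmult_1_l (/ _)), <- Hc. field. exact Hth.
Qed.

(** The square of the modulus, multiplied by (N + 1) / N, is
    N!^2 (N + 1) divided by the product, and this decreases because
    N (N + 1) < (N + 1/2)^2. *)
Lemma modulus_seq_ex_lim (s : R) :
  exists a, 0 <= a /\ is_lim_seq (modulus_seq s) a.
Proof.
  set (P := prod_f_R0 (fun m => (INR m + 1 / 2) ^ 2 + s ^ 2)).
  assert (HP : forall n, 0 < P n) by apply prod_shifted_squares_pos.
  set (D := fun n => INR (fact n) ^ 2 * INR (S n) / P n).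
  assert (HD : forall n, 0 <= D n).
  { intros n. apply Rdiv_le_0_compat; [|apply HP].
    apply Rmult_le_pos; [apply pow2_ge_0|apply pos_INR]. }
  destruct (ex_finite_lim_seq_decr D 0) as [d Hd].
  - intros n. unfold D.
    replace (P (S n)) with (P n * ((INR (S n) + 1 / 2) ^ 2 + s ^ 2)) by reflexivity.
    rewrite fact_simpl, mult_INR, (S_INR (S n)).
    assert (HN : 0 < INR (S n)) by (apply lt_0_INR; lia).
    set (N := INR (S n)) in *. pose proof (HP n) as Hp.
    assert (Hf : 0 < INR (fact n)) by apply INR_fact_lt_0.
    set (f := INR (fact n)) in *. set (p := P n) in *.
    assert (Hx : 0 < (N + 1 / 2) ^ 2 + s ^ 2) by nra.
    replace ((N * f) ^ 2 * (N + 1) / (p * ((N + 1 / 2) ^ 2 + s ^ 2)))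
      with (f ^ 2 * N / p * (N * (N + 1) / ((N + 1 / 2) ^ 2 + s ^ 2)))
      by (field; split; nra).
    rewrite <- (Rmult_1_r (f ^ 2 * N / p)) at 2.
    apply Rmult_le_compat_l.
    + apply Rdiv_le_0_compat; nra.
    + apply Rmult_le_reg_r with ((N + 1 / 2) ^ 2 + s ^ 2); [exact Hx|].
      unfold Rdiv at 1. rewrite Rmult_assoc, Rinv_l by lra. nra.
  - exact HD.
  - exists (sqrt (d * 1)). split; [apply sqrt_pos|].
    apply is_lim_seq_ext_loc with (fun n => sqrt (D n * (INR n / INR (S n)))).
    + exists 1%nat. intros n Hn.
      assert (HN : 0 < INR n) by (apply lt_0_INR; lia).
      assert (HN1 : 0 < INR (S n)) by (apply lt_0_INR; lia).
      unfold modulus_seq. fold P.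
      pose proof (INR_fact_lt_0 n) as Hf. pose proof (exp_pos (1 / 2 * ln (INR n))) as He.
      pose proof (sqrt_lt_R0 _ (HP n)) as Hs.
      assert (Hm : 0 <= INR (fact n) * exp (1 / 2 * ln (INR n)) / sqrt (P n))
        by (apply Rdiv_le_0_compat; [nra|exact Hs]).
      rewrite <- (sqrt_pow2 _ Hm). f_equal.
      unfold D, Rdiv. rewrite !Rpow_mult_distr, pow_inv, pow2_sqrt by (left; apply HP).
      replace (exp (1 * / 2 * ln (INR n)) ^ 2) with (INR n).
      * pose proof (HP n). field. lra.
      * simpl. rewrite Rmult_1_r, <- exp_plus.
        replace (1 * / 2 * ln (INR n) + 1 * / 2 * ln (INR n)) with (ln (INR n)) by field.
        now rewrite exp_ln.
    + apply (is_lim_seq_continuous sqrt).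
      * apply continuity_pt_filterlim, continuous_sqrt.
      * apply is_lim_seq_mult'; [exact Hd|].
        apply is_lim_seq_of_rate with 1. intros n Hn.
        assert (HN : 0 < INR n) by (apply lt_0_INR; lia).
        rewrite S_INR.
        replace (INR n / (INR n + 1) - 1) with (- / (INR n + 1)) by (field; lra).
        rewrite Rabs_Ropp, Rabs_pos_eq by (left; apply Rinv_0_lt_compat; lra).
        unfold Rdiv. rewrite Rmult_1_l. apply Rinv_le_contravar; lra.
Qed.

Lemma Gamma_polar (s : R) :
  exists a, 0 <= a /\ Gamma (1 / 2, s) = (RtoC a * cis (phase s))%C.
Proof.
  destruct (modulus_seq_ex_lim s) as [a [Ha Hlim]].
  exists a. split; [exact Ha|].
  unfold Gamma, cis, RtoC, Cmult; cbn [fst snd].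
  rewrite !Rmult_0_l, Rminus_0_r, Rplus_0_r.
  f_equal.
  - rewrite (Lim_seq_ext _ (fun n => modulus_seq s n * cos (phase_seq s n))).
    + apply (f_equal real (y := Finite (a * cos (phase s)))), is_lim_seq_unique.
      apply is_lim_seq_mult'; [exact Hlim|].
      apply (is_lim_seq_continuous cos); [apply continuity_cos|apply phase_seq_lim].
    + intros n. rewrite Gamma_seq_polar. unfold cis, RtoC, Cmult, Re; simpl. ring.
  - rewrite (Lim_seq_ext _ (fun n => modulus_seq s n * sin (phase_seq s n))).
    + apply (f_equal real (y := Finite (a * sin (phase s)))), is_lim_seq_unique.
      apply is_lim_seq_mult'; [exact Hlim|].
      apply (is_lim_seq_continuous sin); [apply continuity_sin|apply phase_seq_lim].
    + intros n. rewrite Gamma_seq_polar. unfold cis, RtoC, Cmult, Im; simpl. ring.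
Qed.

Lemma Im_lnGamma_continuous (L : C -> C) (s : R) :
  is_lnGamma L -> continuity_pt (fun s => Im (L (1 / 2, s))) s.
Proof.
  intros [Hol _].
  assert (Hsl : slit_plane (1 / 2, s)) by (intros [_ H]; simpl in H; lra).
  specialize (Hol _ Hsl). apply ex_derive_continuous in Hol.
  intros eps Heps.
  destruct (proj1 (filterlim_locally _ _) Hol (mkposreal eps Heps)) as [d Hd].
  exists d. split; [apply cond_pos|].
  intros x [_ Hx]. simpl in *. unfold Rdist in *.
  assert (Hb : ball ((1 / 2, s) : AbsRing_UniformSpace C_AbsRing) d ((1 / 2, x) : C)).
  { unfold ball; simpl. unfold AbsRing_ball, abs, minus, plus, opp; simpl.
    unfold Cmod, Cplus, Copp; simpl.
    replace ((1 / 2 + - (1 / 2)) * ((1 / 2 + - (1 / 2)) * 1)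
             + (x + - s) * ((x + - s) * 1)) with ((x - s)²) by (unfold Rsqr; ring).
    rewrite sqrt_Rsqr_abs. exact Hx. }
  specialize (Hd _ Hb).
  unfold ball in Hd; simpl in Hd.
  unfold AbsRing_ball, abs, minus, plus, opp in Hd; simpl in Hd.
  eapply Rle_lt_trans; [|exact Hd].
  eapply Rle_trans; [|apply Rmax_Cmod]. apply Rmax_r.
Qed.

(** Both e^(lnGamma) and the polar form equal Gamma. The modulus is positive
    since an exponential does not vanish, so the two angles agree modulo
    2 PI. *)
Lemma cos_Im_lnGamma_minus_phase (L : C -> C) (s : R) :
  is_lnGamma L -> cos (Im (L (1 / 2, s)) - phase s) = 1.
Proof.
  intros [_ [Hexp _]].
  assert (Hsl : slit_plane (1 / 2, s)) by (intros [_ H]; simpl in H; lra).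
  specialize (Hexp _ Hsl). destruct (Gamma_polar s) as [a [Ha HG]].
  rewrite HG in Hexp. unfold Cexp, cis, RtoC, Cmult in Hexp; cbn [fst snd] in Hexp.
  injection Hexp as Hre Him. rewrite Rmult_0_l in Hre, Him.
  set (la := Im (L (1 / 2, s))) in *. set (e := exp (Re (L (1 / 2, s)))) in *.
  assert (He : 0 < e) by apply exp_pos.
  pose proof (sin2_cos2 la) as H1. pose proof (sin2_cos2 (phase s)) as H2.
  unfold Rsqr in H1, H2.
  assert (Hea : e = a).
  { assert (E : e * e = a * a).
    { replace (e * e) with ((e * cos la) * (e * cos la) + (e * sin la) * (e * sin la))
        by (transitivity (e * e * (sin la * sin la + cos la * cos la)); [ring|rewrite H1; ring]).
      rewrite Hre, Him.
      transitivity (a * a * (sin (phase s) * sin (phase s) + cos (phase s) * cos (phase s)));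
        [ring|rewrite H2; ring]. }
    nra. }
  rewrite <- Hea in Hre, Him.
  rewrite Rminus_0_r in Hre. rewrite Rplus_0_r in Him.
  apply Rmult_eq_reg_l in Hre; [|lra]. apply Rmult_eq_reg_l in Him; [|lra].
  rewrite cos_minus, Hre, Him. lra.
Qed.

(** A continuous function with values in 2 PI Z is constant, by the
    intermediate value theorem. *)
Lemma continuous_cos_1_zero (h : R -> R) (t : R) :
  0 < t -> (forall s, continuity_pt h s) -> h 0 = 0 ->
  (forall s, cos (h s) = 1) -> h t = 0.
Proof.
  intros Ht Hc H0 Hcos.
  assert (Hpos : forall f : R -> R, (forall s, continuity_pt f s) -> f 0 = 0 ->
    (forall s, cos (f s) = 1) -> f t <= 0).
  { intros f Hf Hf0 Hfc. apply Rnot_lt_le. intros Hlt. pose proof PI_RGT_0.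
    (* f takes the value v in (0, PI/2], where the cosine is below 1 *)
    set (v := Rmin (f t) PI / 2).
    assert (Hv : 0 < v < f t /\ v <= PI / 2).
    { unfold v. pose proof (Rmin_l (f t) PI). pose proof (Rmin_r (f t) PI).
      assert (0 < Rmin (f t) PI) by (apply Rmin_glb_lt; lra). lra. }
    destruct (IVT (fun s => f s - v) 0 t) as [z [_ Hz]].
    - intros a. apply continuity_pt_minus; [apply Hf|apply continuity_pt_const].
      now intros x y.
    - exact Ht.
    - lra.
    - lra.
    - pose proof (Hfc z) as E. replace (f z) with v in E by lra.
      pose proof (cos_decreasing_1 0 v). rewrite cos_0 in *. lra. }
  apply Rle_antisym; [now apply Hpos|].
  enough (- h t <= 0) by lra.
  apply (Hpos (fun s => - h s)).
  - intros s. apply continuity_pt_opp, Hc.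
  - lra.
  - intros s. now rewrite cos_neg.
Qed.

Lemma Im_lnGamma_eq_phase (L : C -> C) (t : R) :
  is_lnGamma L -> 0 < t -> Im (L (1 / 2, t)) = phase t.
Proof.
  intros HL Ht. apply Rminus_diag_uniq.
  apply (continuous_cos_1_zero (fun s => Im (L (1 / 2, s)) - phase s)); [exact Ht| | |].
  - intros s. apply (continuity_pt_minus (fun s => Im (L (1 / 2, s))));
      [now apply Im_lnGamma_continuous|apply phase_continuous].
  - rewrite phase_at_0. destruct HL as [_ [_ Hreal]].
    change ((1 / 2, 0) : C) with (RtoC (1 / 2)). rewrite Hreal by lra. simpl. ring.
  - intros s. now apply cos_Im_lnGamma_minus_phase.
Qed.

(** * The remainder on the imaginary axis *)

(** With z = i t, the imaginary part of z log z is t ln t, and the principal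
    argument only enters the real part. *)
Lemma Im_Rhat (L : C -> C) (t : R) (k : nat) :
  0 < t ->
  Im (Rhat L (k + 1) (Ci * RtoC t))
  = Im (L (1 / 2, t)) - (t * ln t - t
      + Im (sum_n_m (G := C_AbelianMonoid) (fun j => That j (Ci * RtoC t)) 1 k)).
Proof.
  intros Ht. unfold Rhat. rewrite Nat.add_sub.
  set (s := sum_n_m _ 1 k).
  replace (Ci * RtoC t)%C with ((0, t) : C)
    by (unfold Ci, RtoC, Cmult; simpl; f_equal; ring).
  replace ((0, t) + RtoC (1 / 2))%C with (((1 / 2)%R, t) : C)
    by (unfold Cplus, RtoC; cbn [fst snd]; f_equal; ring).
  assert (Hlog : Im ((0, t) * Clog (0, t))%C = t * ln t).
  { unfold Clog, Cmod, Cmult, Im; cbn [fst snd].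
    replace (0 ^ 2 + t ^ 2) with (t ^ 2) by ring.
    rewrite sqrt_pow2 by lra. ring. }
  set (w := ((0, t) * Clog (0, t))%C) in *.
  transitivity (Im (L (1 / 2, t)) - (Im w - t + 0 + Im s)).
  - unfold Cminus, Cplus, Copp, RtoC, Im; cbn [fst snd]. ring.
  - rewrite Hlog. ring.
Qed.

Lemma Rtilde_Im (L : C -> C) (k : nat) (t : R) :
  Rtilde L k t = 1 / 2 * Im (Rhat L k (Ci * RtoC t)).
Proof.
  unfold Rtilde. destruct (Rhat L k (Ci * RtoC t)) as [u v].
  unfold RtoC, Cmult, Im; cbn [fst snd]. ring.
Qed.

(** * Size of the remainder near optimal truncation *)

(** The Wallis factors are ratios of double factorials, so they combine with
    (2k-1)! into the square of (2k-1)!! = (2k)! / (2^k k!), for k = l + 1. *)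
Lemma fact_wallis_half (l : nat) :
  INR (fact (S (2 * l))) * wallis_half l
  = PI / 2 / INR (S (2 * l))
    * (INR (fact (2 * S l)) / (2 ^ S l * INR (fact (S l)))) ^ 2.
Proof.
  assert (HS : forall n, INR (fact (S n)) = (INR n + 1) * INR (fact n))
    by (intros n; rewrite fact_simpl, mult_INR, S_INR; reflexivity).
  induction l as [|l IH].
  - simpl. field.
  - pose proof (pos_INR l) as Hl.
    assert (E1 : INR (2 * l) = 2 * INR l) by (rewrite mult_INR; reflexivity).
    assert (E2 : INR (2 * S l) = 2 * INR l + 2)
      by (rewrite mult_INR, (S_INR l); change (INR 2) with 2; ring).
    assert (F1 : INR (fact (2 * S l)) = (2 * INR l + 2) * INR (fact (S (2 * l)))).
    { replace (2 * S l)%nat with (S (S (2 * l))) at 1 by lia.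
      rewrite (HS (S (2 * l))%nat), S_INR, E1. ring. }
    assert (F2 : INR (fact (2 * S (S l)))
        = (2 * INR l + 4) * (2 * INR l + 3) * INR (fact (2 * S l))).
    { replace (2 * S (S l))%nat with (S (S (2 * S l))) by lia.
      rewrite (HS (S (2 * S l))%nat), (HS (2 * S l)%nat), S_INR, E2. ring. }
    rewrite F2, (HS (2 * S l)%nat), (HS (S l)), !S_INR, E2.
    rewrite S_INR, E1 in IH. cbn [wallis_half]. rewrite S_INR.
    change (2 ^ S (S l)) with (2 * 2 ^ S l).
    pose proof (pow_lt 2 (S l) ltac:(lra)) as HP.
    pose proof (INR_fact_lt_0 (S l)) as HF.
    transitivity ((2 * INR l + 3) * (2 * INR l + 1)
       * (INR (fact (S (2 * l))) * wallis_half l)).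
    + rewrite F1. field. lra.
    + rewrite IH.
      set (P := 2 ^ S l) in *. set (F := INR (fact (S l))) in *.
      set (B := INR (fact (2 * S l))). field. repeat split; lra.
Qed.

(** The logarithm of n! / (n^n e^-n sqrt n), which decreases to
    ln (2 PI) / 2. *)
Definition stirling_defect (n : nat) : R :=
  ln (INR (fact n)) - (INR n + 1 / 2) * ln (INR n) + INR n.

Lemma ln_ratio_lower (x : R) : 0 < x -> 1 <= (x + 1 / 2) * (ln (x + 1) - ln x).
Proof.
  intros Hx.
  (* log (1 + y) >= 2 y / (2 + y) at y = 1 / x *)
  assert (H : ln (1 + 0) - 2 * 0 / (2 + 0) <= ln (1 + / x) - 2 * / x / (2 + / x)).
  { assert (Hi : 0 < / x) by now apply Rinv_0_lt_compat.
    destruct (mean_value (fun y => ln (1 + y) - 2 * y / (2 + y))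
      (fun y => y ^ 2 / ((1 + y) * (2 + y) ^ 2)) 0 (/ x)) as [c [Hc E]].
    - lra.
    - intros y Hy. auto_derive; [lra|]. field. lra.
    - assert (0 <= c ^ 2 / ((1 + c) * (2 + c) ^ 2)).
      { apply Rdiv_le_0_compat; [nra|]. apply Rmult_lt_0_compat; nra. }
      cbv beta in E. nra. }
  rewrite Rplus_0_r, ln_1 in H.
  replace (ln (x + 1) - ln x) with (ln (1 + / x)).
  - replace (2 * / x / (2 + / x)) with (/ (x + 1 / 2)) in H by (field; lra).
    apply Rmult_le_reg_l with (/ (x + 1 / 2)); [apply Rinv_0_lt_compat; lra|].
    rewrite <- Rmult_assoc, Rinv_l by lra. lra.
  - replace (x + 1) with (x * (1 + / x)) by (field; lra).
    assert (0 < / x) by now apply Rinv_0_lt_compat.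
    rewrite ln_mult by lra. ring.
Qed.

(** One step changes the defect by 1 - (n + 1/2) ln (1 + 1/n), which is
    nonpositive by [ln_ratio_lower]. *)
Lemma stirling_defect_decr (n m : nat) :
  (1 <= n)%nat -> (n <= m)%nat -> stirling_defect m <= stirling_defect n.
Proof.
  intros Hn Hm. induction Hm as [|m Hm IH]; [lra|].
  assert (Hp : 0 < INR m) by (apply lt_0_INR; lia).
  eapply Rle_trans; [|exact IH]. unfold stirling_defect.
  rewrite fact_simpl, mult_INR, S_INR, ln_mult by (lra || apply INR_fact_lt_0).
  pose proof (ln_ratio_lower (INR m) Hp). lra.
Qed.

(** The constant of Stirling's formula cancels in (2k)! / k!, so the
    monotonicity of the defect between k and 2k already gives the optimal
    constant sqrt 2 for the double factorial, hence 2 for its square. *)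
Lemma odd_double_factorial_le (k : nat) :
  (1 <= k)%nat ->
  (INR (fact (2 * k)) / (2 ^ k * INR (fact k))) ^ 2
  <= 2 * exp (2 * INR k * (ln 2 + ln (INR k) - 1)).
Proof.
  intros Hk.
  assert (Hx : 0 < INR k) by (apply lt_0_INR; lia).
  pose proof (INR_fact_lt_0 k) as F1. pose proof (INR_fact_lt_0 (2 * k)) as F2.
  pose proof (pow_lt 2 k ltac:(lra)) as Hp.
  assert (Hpos : 0 < INR (fact (2 * k)) / (2 ^ k * INR (fact k)))
    by (apply Rdiv_lt_0_compat; [|apply Rmult_lt_0_compat]; lra).
  assert (Hden : 0 < 2 ^ k * INR (fact k)) by now apply Rmult_lt_0_compat.
  pose proof (Rinv_0_lt_compat _ Hden) as Hinv.
  assert (Hln : ln (INR (fact (2 * k)) / (2 ^ k * INR (fact k)))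
                <= 1 / 2 * ln 2 + INR k * (ln 2 + ln (INR k) - 1)).
  { unfold Rdiv at 1. rewrite ln_mult by assumption.
    rewrite ln_Rinv by assumption. rewrite ln_mult, ln_pow by (assumption || lra).
    pose proof (stirling_defect_decr k (2 * k) Hk ltac:(lia)) as H.
    unfold stirling_defect in H. rewrite mult_INR in H.
    change (INR 2) with 2 in H. rewrite ln_mult in H by lra. lra. }
  set (D := INR (fact (2 * k)) / (2 ^ k * INR (fact k))) in *.
  replace (D ^ 2) with (exp (ln D + ln D))
    by (rewrite exp_plus, exp_ln by exact Hpos; ring).
  rewrite <- (exp_ln 2) at 1 by lra. rewrite <- exp_plus.
  apply exp_le_compat. lra.
Qed.

(** Rewrites the bound of [phase_expansion] in terms of p = PI t: the powers
    of 2 PI and t join k^2k into (k/p)^2k. *)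
Lemma remainder_constant_le (t : R) (l : nat) :
  0 < t ->
  2 / (2 * PI) ^ S (S (2 * l)) * (1 + 4 / 2 ^ S (S (2 * l)))
     * (INR (fact (S (2 * l))) / t ^ S (2 * l) * wallis_half l)
  <= (1 + 4 / 2 ^ (2 * S l)) * (2 * (PI * t) / (2 * INR (S l) - 1))
     * exp (2 * INR (S l) * (ln (INR (S l)) - ln (PI * t) - 1)).
Proof.
  intros Ht. pose proof PI_RGT_0 as HPI.
  set (k := S l). assert (Hx : 1 <= INR k) by (apply (le_INR 1); lia).
  set (x := INR k) in *.
  replace (S (S (2 * l))) with (2 * k)%nat by lia.
  assert (HPt : 0 < PI * t) by nra.
  assert (Hq : (2 * PI) ^ (2 * k) * t ^ (2 * k)
               = exp (2 * x * (ln 2 + ln (PI * t)))).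
  { rewrite <- Rpow_mult_distr. replace (2 * PI * t) with (2 * (PI * t)) by ring.
    assert (H0 : 0 < (2 * (PI * t)) ^ (2 * k)) by (apply pow_lt; lra).
    rewrite <- (exp_ln _ H0), ln_pow, ln_mult, mult_INR by lra. reflexivity. }
  assert (Htk : t ^ (2 * k) = t * t ^ S (2 * l))
    by (replace (2 * k)%nat with (S (S (2 * l))) by lia; reflexivity).
  pose proof (pow_lt t (S (2 * l)) Ht) as Ht1.
  pose proof (pow_lt (2 * PI) (2 * k) ltac:(lra)) as HP2.
  pose proof (pow_lt 2 (2 * k) ltac:(lra)) as H2.
  assert (HS : INR (S (2 * l)) = 2 * x - 1).
  { unfold x, k. rewrite !S_INR, mult_INR. simpl. ring. }
  pose proof (odd_double_factorial_le k ltac:(lia)) as Hd. fold x in Hd.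
  set (D := (INR (fact (2 * k)) / (2 ^ k * INR (fact k))) ^ 2) in *.
  assert (Hw : INR (fact (S (2 * l))) * wallis_half l = PI / 2 / (2 * x - 1) * D)
    by (rewrite fact_wallis_half, HS; reflexivity).
  replace (2 / (2 * PI) ^ (2 * k) * (1 + 4 / 2 ^ (2 * k))
     * (INR (fact (S (2 * l))) / t ^ S (2 * l) * wallis_half l))
    with ((1 + 4 / 2 ^ (2 * k)) * (2 / ((2 * PI) ^ (2 * k) * t ^ S (2 * l)))
           * (INR (fact (S (2 * l))) * wallis_half l))
    by (field; repeat split; lra).
  rewrite Hw.
  replace ((2 * PI) ^ (2 * k) * t ^ S (2 * l))
    with (exp (2 * x * (ln 2 + ln (PI * t))) / t)
    by (rewrite <- Hq, Htk; field; lra).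
  pose proof (exp_pos (2 * x * (ln 2 + ln (PI * t)))) as He.
  replace (2 * x * (ln x - ln (PI * t) - 1))
    with (2 * x * (ln 2 + ln x - 1) + - (2 * x * (ln 2 + ln (PI * t)))) by ring.
  rewrite exp_plus, exp_Ropp.
  set (E := exp (2 * x * (ln 2 + ln (PI * t)))) in *.
  set (Y := exp (2 * x * (ln 2 + ln x - 1))) in *.
  assert (H4 : 0 < 4 / 2 ^ (2 * k)) by (apply Rdiv_lt_0_compat; lra).
  rewrite !Rmult_assoc. apply Rmult_le_compat_l; [lra|].
  replace (2 / (E / t) * (PI / 2 / (2 * x - 1) * D))
    with (PI * t / (2 * x - 1) / E * D) by (field; lra).
  replace (2 * (PI * t) / (2 * x - 1) * (Y * / E))
    with (PI * t / (2 * x - 1) / E * (2 * Y)) by (field; lra).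
  apply Rmult_le_compat_l; [|exact Hd].
  apply Rdiv_le_0_compat; [apply Rdiv_le_0_compat; lra|exact He].
Qed.

(** From ln (x/p) <= x/p - 1 the exponent is at most 2 x (x/p - 2), which
    equals - 2 p + 2 (x - p)^2 / p. *)
Lemma exponent_near_optimum (x p K : R) :
  0 < x -> 0 < p -> Rabs (x - p) <= K ->
  2 * x * (ln x - ln p - 1) <= - 2 * p + 2 * K ^ 2 / p.
Proof.
  intros Hx Hp HK.
  assert (Hln : ln x - ln p <= x / p - 1).
  { pose proof (exp_ineq1_le (ln x - ln p)) as H.
    unfold Rminus in H. rewrite exp_plus, exp_Ropp, !exp_ln in H by lra.
    unfold Rdiv. lra. }
  assert (Hsq : (x - p) ^ 2 <= K ^ 2).
  { rewrite <- (pow2_abs (x - p)). apply pow_incr. split; [apply Rabs_pos|exact HK]. }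
  apply Rle_trans with (2 * x * (x / p - 2)).
  - apply Rmult_le_compat_l; lra.
  - replace (2 * x * (x / p - 2)) with (- 2 * p + 2 * (x - p) ^ 2 / p) by (field; lra).
    apply Rplus_le_compat_l, Rmult_le_compat_r; [|lra].
    left; now apply Rinv_0_lt_compat.
Qed.

(** The higher powers of e in the product are at most e, as e <= 1. *)
Lemma three_factors_le (a b c e : R) :
  0 <= a -> 0 <= b -> 0 <= c -> 0 <= e <= 1 ->
  (1 + a * e) * (1 + b * e) * (1 + c * e)
  <= 1 + ((1 + a) * (1 + b) * (1 + c) - 1) * e.
Proof.
  intros Ha Hb Hc He.
  assert (0 <= a * b) by nra. assert (0 <= a * c) by nra.
  assert (0 <= b * c) by nra. assert (0 <= a * b * c) by nra.
  assert (e ^ 2 <= e) by nra. assert (0 <= e ^ 3 <= e) by nra.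
  replace ((1 + a * e) * (1 + b * e) * (1 + c * e))
    with (1 + (a + b + c) * e + (a * b + a * c + b * c) * e ^ 2 + a * b * c * e ^ 3)
    by ring.
  nra.
Qed.

Lemma four_div_pow_le (k : nat) : (1 <= k)%nat -> 4 / 2 ^ (2 * k) <= 2 / INR k.
Proof.
  intros Hk. assert (Hx : 0 < INR k) by (apply lt_0_INR; lia).
  pose proof (poly (2 * k) 1 ltac:(lra)) as H. rewrite mult_INR in H. simpl (INR 2) in H.
  replace (1 + 1) with 2 in H by ring.
  replace (2 / INR k) with (4 * / (2 * INR k)) by (field; lra).
  apply Rmult_le_compat_l; [lra|]. apply Rinv_le_contravar; lra.
Qed.

(** The three sources of relative error are the higher harmonics (4 / p),
    the ratio 2 p / (2k - 1) ((2K + 1) / p) and the displacement of k from p in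
    the exponent (4 K^2 / p). *)
Lemma remainder_asymptotics (p K : R) (k : nat) :
  0 < K -> (1 <= k)%nat -> 4 + 4 * K + 4 * K ^ 2 <= p -> Rabs (INR k - p) <= K ->
  (1 + 4 / 2 ^ (2 * k)) * (2 * p / (2 * INR k - 1))
     * exp (2 * INR k * (ln (INR k) - ln p - 1))
  <= exp (- 2 * p) * (1 + (5 * (2 * K + 2) * (1 + 4 * K ^ 2) - 1) / p).
Proof.
  intros HK Hk Hp Hdist.
  assert (Hx : 1 <= INR k) by (apply (le_INR 1); lia).
  pose proof (exponent_near_optimum (INR k) p K ltac:(lra) ltac:(nra) Hdist) as Hexp.
  apply Rabs_le_between in Hdist.
  pose proof (four_div_pow_le k Hk) as H4.
  assert (Hp1 : 0 < / p <= 1).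
  { split; [apply Rinv_0_lt_compat; nra|]. rewrite <- Rinv_1. apply Rinv_le_contravar; nra. }
  assert (A1 : 0 <= 1 + 4 / 2 ^ (2 * k) <= 1 + 4 * / p).
  { pose proof (pow_lt 2 (2 * k) ltac:(lra)).
    assert (0 < 4 / 2 ^ (2 * k)) by (apply Rdiv_lt_0_compat; lra).
    assert (2 / INR k <= 4 * / p).
    { replace (4 * / p) with (2 * / (p / 2)) by (field; nra).
      apply Rmult_le_compat_l; [lra|]. apply Rinv_le_contravar; nra. }
    lra. }
  assert (A2 : 0 <= 2 * p / (2 * INR k - 1) <= 1 + (2 * K + 1) * / p).
  { split; [apply Rdiv_le_0_compat; nra|].
    apply Rle_trans with (2 * p * / (2 * p - 2 * K - 1)).
    - apply Rmult_le_compat_l; [nra|]. apply Rinv_le_contravar; nra.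
    - replace (2 * p * / (2 * p - 2 * K - 1))
        with (1 + (2 * K + 1) * / (2 * p - 2 * K - 1)) by (field; nra).
      apply Rplus_le_compat_l, Rmult_le_compat_l; [lra|].
      apply Rinv_le_contravar; nra. }
  assert (A3 : exp (2 * INR k * (ln (INR k) - ln p - 1))
               <= exp (- 2 * p) * (1 + 4 * K ^ 2 * / p)).
  { apply Rle_trans with (exp (- 2 * p + 2 * K ^ 2 / p)).
    - apply exp_le_compat, Hexp.
    - rewrite exp_plus. apply Rmult_le_compat_l; [left; apply exp_pos|].
      replace (4 * K ^ 2 * / p) with (2 * (2 * K ^ 2 / p)) by (unfold Rdiv; ring).
      apply exp_le_linear. split; [apply Rdiv_le_0_compat; nra|].
      apply Rmult_le_reg_r with p; [nra|].
      unfold Rdiv. rewrite Rmult_assoc, Rinv_l; nra. }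
  pose proof (three_factors_le 4 (2 * K + 1) (4 * K ^ 2) (/ p)
    ltac:(lra) ltac:(lra) ltac:(nra) ltac:(lra)) as H3.
  replace ((1 + 4) * (1 + (2 * K + 1)) * (1 + 4 * K ^ 2))
    with (5 * (2 * K + 2) * (1 + 4 * K ^ 2)) in H3 by ring.
  apply Rle_trans with ((1 + 4 * / p) * (1 + (2 * K + 1) * / p)
     * (exp (- 2 * p) * (1 + 4 * K ^ 2 * / p))).
  - apply Rmult_le_compat; [apply Rmult_le_pos; lra|left; apply exp_pos| |exact A3].
    apply Rmult_le_compat; lra.
  - replace ((1 + 4 * / p) * (1 + (2 * K + 1) * / p)
     * (exp (- 2 * p) * (1 + 4 * K ^ 2 * / p)))
      with (exp (- 2 * p) * ((1 + 4 * / p) * (1 + (2 * K + 1) * / p) * (1 + 4 * K ^ 2 * / p)))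
      by ring.
    apply Rmult_le_compat_l; [left; apply exp_pos|exact H3].
Qed.

Theorem corollary5 :
  forall lnGamma : C -> C, is_lnGamma lnGamma ->
  forall K : R, 0 < K ->
  exists K' t0 : R, 0 < K' /\ 0 < t0 /\
    forall (t : R) (k : nat),
      t0 <= t -> (1 <= k)%nat -> Rabs (INR k - PI * t) <= K ->
      Rabs (Rtilde lnGamma (k + 1) t) < 1 / 2 * exp (- 2 * PI * t) * (1 + K' / t).
Proof.
  intros L HL K HK.
  exists (5 * (2 * K + 2) * (1 + 4 * K ^ 2)), (4 + 4 * K + 4 * K ^ 2).
  assert (HK' : 0 < 5 * (2 * K + 2) * (1 + 4 * K ^ 2))
    by (apply Rmult_lt_0_compat; nra).
  split; [exact HK'|]. split; [nra|].
  intros t k Ht Hk Hdist.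
  destruct k as [|l]; [lia|].
  assert (Ht0 : 0 < t) by nra.
  assert (HPI : 1 <= PI) by (pose proof PI2_1; lra).
  assert (Htp : t <= PI * t) by nra.
  rewrite Rtilde_Im, Im_Rhat, Im_lnGamma_eq_phase, Rabs_mult, (Rabs_pos_eq (1 / 2))
    by (exact HL || lra).
  rewrite Rmult_assoc. apply Rmult_lt_compat_l; [lra|].
  eapply Rle_lt_trans; [apply phase_expansion; [exact Ht0|apply phase_seq_lim]|].
  eapply Rle_lt_trans; [apply remainder_constant_le, Ht0|].
  eapply Rle_lt_trans; [apply (remainder_asymptotics _ K); [exact HK|lia|lra|exact Hdist]|].
  rewrite <- Rmult_assoc. apply Rmult_lt_compat_l; [apply exp_pos|].
  apply Rplus_lt_compat_l.
  set (Q := 5 * (2 * K + 2) * (1 + 4 * K ^ 2)) in *.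
  assert (H1 : / (PI * t) <= / t) by (apply Rinv_le_contravar; lra).
  assert (H2 : 0 < / (PI * t)) by (apply Rinv_0_lt_compat; lra).
  unfold Rdiv. nra.
Qed.
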